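(* Let $p,q\ge 1$, let $\mathbb{M}\subset\mathrm{Gr}_p(\mathbb{R}^{p+q})$ be an affine chart, let $\Omega\subset\mathbb{M}$ be a nonempty $\mathcal{R}$-proper open convex subset of $\mathbb{M}$, and suppose $\mathrm{Aut}(\Omega)$ acts cocompactly on $\Omega$. If $A_n\in\mathrm{Aff}(\mathbb{M})\cap\mathrm{PGL}_{p+q}(\mathbb{R})$ and $A_n\Omega$ is a sequence of $\mathcal{R}$-proper convex sets converging in the local Hausdorff topology to a nonempty $\mathcal{R}$-proper convex open set $\widehat{\Omega}\subset\mathbb{M}$, then there exists $\Phi\in\mathrm{PGL}_{p+q}(\mathbb{R})$ such that $\Phi(\Omega)=\widehat{\Omega}$.
   Context: $\mathrm{Gr}_p(\mathbb{R}^{p+q})$ is the Grassmannian of $p$-dimensional subspaces of $\mathbb{R}^{p+q}$, with its natural $\mathrm{PGL}_{p+q}(\mathbb{R})$-action, regarded as a closed subset of $\mathbb{P}(\wedge^p\mathbb{R}^{p+q})$ via $\mathrm{Span}(v_1,\dots,v_p)\mapsto[v_1\wedge\dots\wedge v_p]$. An affine chart is a set $\mathbb{M}=\{U: U\cap W_0=(0)\}$ for some $q$-dimensional subspace $W_0$. Fixing $U_0\in\mathbb{M}$ one identifies $\mathbb{M}$ with $\mathrm{Hom}(U_0,W_0)$ by $T\mapsto\{u+Tu:u\in U_0\}$, hence (choosing bases) with $M_{q,p}(\mathbb{R})\cong\mathbb{R}^{pq}$; different choices change this by $X\mapsto AXB+C$ with $A,B$ invertible, so convexity and affine maps are well defined.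 $\mathrm{Aff}(\mathbb{M})$ is the group of affine transformations of $\mathbb{M}$ under such an identification, and $\mathrm{Aff}(\mathbb{M})\cap\mathrm{PGL}_{p+q}(\mathbb{R})$ consists of the elements of $\mathrm{PGL}_{p+q}(\mathbb{R})$ which preserve $\mathbb{M}$ and act on it by an affine map. $\mathrm{Aut}(\Omega)=\{\varphi\in\mathrm{PGL}_{p+q}(\mathbb{R}):\varphi\Omega=\Omega\}$, and it acts cocompactly if $\mathrm{Aut}(\Omega)\cdot K=\Omega$ for some compact $K\subset\Omega$. Let $\mathcal{L}$ be the set of projective lines of $\mathbb{P}(\wedge^p\mathbb{R}^{p+q})$ contained in $\mathrm{Gr}_p(\mathbb{R}^{p+q})$; an open connected set $\Omega$ is $\mathcal{R}$-proper if $|\ell\setminus(\ell\cap\Omega)|>1$ for all $\ell\in\mathcal{L}$. Local Hausdorff convergence: identify $\mathbb{M}$ with $\mathbb{R}^{pq}$. For $A\subset\mathbb{R}^{pq}$ and $R>0$ let $A^{(R)}=A\cap B_R(0)$, with $B_R(0)$ the closed Euclidean ball. $d_H(A,B)=\inf\{\epsilon>0: A\subset\mathcal{N}_\epsilon(B),\ B\subset\mathcal{N}_\epsilon(A)\}$, where $\mathcal{N}_\epsilon$ is the Euclidean $\epsilon$-neighborhood. Open convex sets $A_n$ converge to an open convex set $A$ in the local Hausdorff topology if $d_H(\overline{A_n}^{(R)},\overline{A}^{(R)})\to0$ for all $R>0$. *)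

(* Defs.v *)
From HB Require Import structures.
From mathcomp Require Import all_boot all_order all_algebra.
From mathcomp Require Import all_classical all_reals all_analysis.

Set Implicit Arguments.
Unset Strict Implicit.
Unset Printing Implicit Defensive.

Import Order.TTheory GRing.Theory Num.Theory.
Import numFieldNormedType.Exports.

Local Open Scope classical_set_scope.
Local Open Scope ring_scope.

Definition Gr (R : realType) (p n : nat) : set {vspace 'rV[R]_n} :=
  [set U | \dim U = p].
Arguments Gr : clear implicits.

(* PGL_n acts faithfully on the subspaces of R^n; it is identified with the
   group of transformations of the subspaces induced by invertible linear
   maps. *)
Definition PGL (R : realType) (n : nat) :
    set ({vspace 'rV[R]_n} -> {vspace 'rV[R]_n}) :=
  [set phi | exists g : 'End('rV[R]_n),
     lker g = 0%VS /\ phi = (fun U => (g @: U)%VS)].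

Definition AutGr (R : realType) (n : nat) (Om : set {vspace 'rV[R]_n}) :
    set ({vspace 'rV[R]_n} -> {vspace 'rV[R]_n}) :=
  [set phi | PGL phi /\ phi @` Om = Om].

(* The exterior power is modelled by coordinates in the basis
   e_(f 0) /\ ... /\ e_(f (p-1)) indexed by the increasing maps
   f : 'I_p -> 'I_n. *)
Definition incr_map (p n : nat) :=
  {f : {ffun 'I_p -> 'I_n} |
     [forall i : 'I_p, forall j : 'I_p, (i < j)%N ==> (f i < f j)%N]}.

Definition extpow (R : realType) (p n : nat) := {ffun incr_map p n -> R^o}.

(* The coordinates of v_0 /\ ... /\ v_(p-1) are the p x p minors of the
   matrix with rows v_0, ..., v_(p-1). *)
Definition wedgev (R : realType) (p n : nat) (v : p.-tuple 'rV[R]_n) :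
    extpow R p n :=
  [ffun f : incr_map p n => \det (\matrix_(i, j) tnth v i 0 (val f j))].

(* Points of the projective space P(E) are the one-dimensional subspaces of E.
   [plucker S] is the image of S `<=` Gr p n under
   Span(v_0, ..., v_(p-1)) |-> [v_0 /\ ... /\ v_(p-1)]. *)
Definition plucker (R : realType) (p n : nat) (S : set {vspace 'rV[R]_n}) :
    set {vspace extpow R p n} :=
  [set P | exists v : p.-tuple 'rV[R]_n,
     [/\ free v, S <<v>>%VS & P = <[wedgev v]>%VS]].
Arguments plucker {R} p {n} S.

Definition is_proj_line (R : realType) (E : vectType R) (l : set {vspace E}) :=
  exists L : {vspace E},
    \dim L = 2%N /\ l = [set P | \dim P = 1%N /\ (P <= L)%VS].

Definition Gr_lines (R : realType) (p n : nat) : set (set {vspace extpow R p n}) :=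
  [set l | is_proj_line l /\ l `<=` plucker p (Gr R p n)].
Arguments Gr_lines : clear implicits.

Definition Rproper (R : realType) (p n : nat) (Om : set {vspace 'rV[R]_n}) :=
  forall l, Gr_lines R p n l ->
    exists P Q, [/\ P <> Q, (l `\` (l `&` plucker p Om)) P
                          & (l `\` (l `&` plucker p Om)) Q].

Definition affine_chart (R : realType) (p n : nat) (W0 : {vspace 'rV[R]_n}) :
    set {vspace 'rV[R]_n} :=
  [set U | Gr R p n U /\ (U :&: W0)%VS = 0%VS].
Arguments affine_chart {R} p {n} W0.

(* The graph {x + T x : x in U0} of the linear map T : U0 -> W0 whose matrix
   is X in the bases u of U0 and w of W0. *)
Definition graph (R : realType) (p q n : nat)
    (u : p.-tuple 'rV[R]_n) (w : q.-tuple 'rV[R]_n) (X : 'M[R]_(q, p)) :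
    {vspace 'rV[R]_n} :=
  <<[tuple (tnth u i + \sum_(k < q) X k i *: tnth w k)%R | i < p]>>%VS.

Definition incoord (R : realType) (p q n : nat)
    (u : p.-tuple 'rV[R]_n) (w : q.-tuple 'rV[R]_n)
    (S : set {vspace 'rV[R]_n}) : set 'M[R]_(q, p) :=
  [set X | S (graph u w X)].

Definition AffPGL (R : realType) (p q n : nat) (W0 : {vspace 'rV[R]_n})
    (u : p.-tuple 'rV[R]_n) (w : q.-tuple 'rV[R]_n) :
    set ({vspace 'rV[R]_n} -> {vspace 'rV[R]_n}) :=
  [set phi | [/\ PGL phi, phi @` affine_chart p W0 = affine_chart p W0 &
     exists (L : {linear 'M[R]_(q, p) -> 'M[R]_(q, p)}) (C : 'M[R]_(q, p)),
       forall X, phi (graph u w X) = graph u w (L X + C)]].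

Definition cocompact (R : realType) (p q n : nat)
    (u : p.-tuple 'rV[R]_n) (w : q.-tuple 'rV[R]_n)
    (Om : set {vspace 'rV[R]_n}) :=
  exists K : set {vspace 'rV[R]_n},
    [/\ K `<=` Om, compact (incoord u w K)
      & \bigcup_(phi in AutGr Om) (phi @` K) = Om].

(* The library norm on matrices is the sup norm. *)
Definition eucl_norm (R : realType) (m n : nat) (X : 'M[R]_(m, n)) : R :=
  Num.sqrt (\sum_i \sum_j X i j ^+ 2).

Definition trunc (R : realType) (m n : nat) (A : set 'M[R]_(m, n)) (r : R) :
    set 'M[R]_(m, n) :=
  A `&` [set X | eucl_norm X <= r].

Definition eucl_nbhd (R : realType) (m n : nat) (A : set 'M[R]_(m, n)) (e : R) :
    set 'M[R]_(m, n) :=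
  [set X | exists2 Y, A Y & eucl_norm (X - Y) < e].

(* Extended-real valued: the distance from a nonempty set to the empty set
   is +oo. *)
Definition hausdorff_dist (R : realType) (m n : nat) (A B : set 'M[R]_(m, n)) :
    \bar R :=
  ereal_inf [set e%:E | e in
    [set e : R | [/\ 0 < e, A `<=` eucl_nbhd B e & B `<=` eucl_nbhd A e]]].

Definition local_hausdorff_cvg (R : realType) (m n : nat)
    (A : nat -> set 'M[R]_(m, n)) (B : set 'M[R]_(m, n)) :=
  forall r : R, 0 < r ->
    (fun k => hausdorff_dist (trunc (closure (A k)) r) (trunc (closure B) r))
      @ \oo --> 0%E.

(* Main.v *)
Require Import Defs.
From HB Require Import structures.
From mathcomp Require Import all_boot all_order all_algebra.
From mathcomp Require Import all_classical all_reals all_analysis.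
From mathcomp Require Import ring lra.

Set Implicit Arguments.
Unset Strict Implicit.
Unset Printing Implicit Defensive.

Import Order.TTheory GRing.Theory Num.Theory.
Import numFieldNormedType.Exports.

Local Open Scope classical_set_scope.
Local Open Scope ring_scope.

(** Write the graph of X as the column span of the block column (1; X). An
    element of PGL then acts on the chart by a fractional linear map
    X |-> (c + d X)(a + b X)^-1 given by an invertible block matrix G. Fix a
    point y0 of the limit domain. For large k it lies in A_k Om, and
    cocompactness moves A_k^-1 y0 into a fixed compact subset of Om by an
    automorphism. So there are invertible G_k, mapping Om onto A_k Om, that
    send a point x_k of that compact set to y0. If the G_k, suitably scaled,
    have an invertible limit G, then G should map Om onto the limit domain.
    Both steps, the existence of G and its surjectivity, need an argument.

    Compactness. Conjugating by translations, G_k fixes the origin, so its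
    block c vanishes and it is a pair of invertible blocks a, d together with
    b. Rank-one directions E = v w are sent to multiples of the rank-one
    matrix E' = d E a^-1, because the line t E is mapped to E' projectively,
    t |-> t / (1 + t nu). A ball of radius r about x_k lies in the source, so
    the pole -1/nu is at distance at least r, which bounds a^-1 b, and the
    points t = r/2 and t = -r/2 show that the target contains the segment
    [-r/3, r/3] E'. If E' were unbounded, these segments would fill, in the
    limit, a whole rank-one affine line; but such a line is a projective line
    of the Grassmannian with one point removed, and R-properness forbids it
    (Rproper_line_free). So the products of the norms of d and a^-1 are
    bounded (derivative_bound). The same holds for the inverses, and once a is
    scaled to norm 1 this bounds G_k and its inverse (conjugate_bounds).

    Passing to the limit. Limits are taken along an ultrafilter finer than the
    neighbourhoods of infinity, which spares the extraction of successive
    subsequences. The limit G could send points of the source to infinity: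
    det(a + b X) might vanish. Along an elementary direction this determinant
    is affine in the parameter, so a zero inside the domain would be a sign
    change, already visible for G_k, whose denominator has no zero on its
    source; hence non-vanishing propagates from the base point along elementary
    directions to the whole domain (limit_den_neq0). Then G maps the source
    into the closure of the target, hence, being open, into the target
    (limit_maps). Applied to G and to its inverse this gives the theorem
    (limit_of_equivalences).

    The two facts about local Hausdorff convergence that are used are that
    limits of points of A_k lie in the closure of the limit, and that a small
    ball about each point of the limit lies in A_k for all large k. *)

(** * Limits of matrices along a filter *)

Lemma cvg_mxP (T : topologicalType) (I : Type) (F : set_system I) (FF : Filter F)
    m n (f : I -> 'M[T]_(m, n)) (A : 'M[T]_(m, n)) :
  (forall i j, (fun k => f k i j) @ F --> A i j) -> f @ F --> A.
Proof.
move=> fA P [Q AQ QP].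
suff FQ : F [set k | forall i j, Q i j (f k i j)].
  by apply: (@filterS _ F _ _ (f @^-1` P) _ FQ) => k Qk; exact: QP.
apply: (@filter_forall _ _ (fun i k => forall j, Q i j (f k i j))) => i.
apply: (@filter_forall _ _ (fun j k => Q i j (f k i j))) => j.
exact: (fA i j _ (AQ i j)).
Qed.

Lemma cvg_coord (K : numFieldType) (I : Type) (F : set_system I) (FF : Filter F)
    m n (f : I -> 'M[K]_(m, n)) (A : 'M[K]_(m, n)) i j :
  f @ F --> A -> (fun k => f k i j) @ F --> A i j.
Proof.
by move=> fA; exact: (cvg_comp f (fun M => M i j) fA (@coord_continuous K m n i j A)).
Qed.

Section matrix_limits.
Variables (R : realType) (I : Type) (F : set_system I).
Hypothesis FF : ProperFilter F.

Lemma cvg_sumr (J : finType) (f : J -> I -> R) (l : J -> R) :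
  (forall j, f j @ F --> l j) -> (fun k => \sum_j f j k) @ F --> \sum_j l j.
Proof. by move=> fl; apply: cvg_big => [|//]; apply: add_continuous. Qed.

Lemma cvg_prodr (J : finType) (f : J -> I -> R) (l : J -> R) :
  (forall j, f j @ F --> l j) -> (fun k => \prod_j f j k) @ F --> \prod_j l j.
Proof. by move=> fl; apply: cvg_big => [|//]; apply: mul_continuous. Qed.

Lemma cvg_mulmx m n r (f : I -> 'M[R]_(m, n)) (g : I -> 'M[R]_(n, r))
    (A : 'M[R]_(m, n)) (B : 'M[R]_(n, r)) :
  f @ F --> A -> g @ F --> B -> (fun k => f k *m g k) @ F --> A *m B.
Proof.
move=> fA gB; apply: cvg_mxP => i j; rewrite mxE.
under [X in X @ _ --> _]eq_fun do rewrite mxE.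
by apply: cvg_sumr => l; apply: cvgM; exact: cvg_coord.
Qed.

Lemma cvg_det n (f : I -> 'M[R]_n) (A : 'M[R]_n) :
  f @ F --> A -> (fun k => \det (f k)) @ F --> \det A.
Proof.
move=> fA; apply: cvg_sumr => s; apply: cvgM; first exact: cvg_cst.
by apply: cvg_prodr => i; exact: cvg_coord.
Qed.

(** Near a unit the inverse is the adjugate divided by the determinant, both
    polynomial in the entries. *)
Lemma cvg_invmx n (f : I -> 'M[R]_n) (A : 'M[R]_n) :
  A \in unitmx -> f @ F --> A -> (fun k => invmx (f k)) @ F --> invmx A.
Proof.
move=> uA fA; have detf := cvg_det fA.
have dA0 : \det A != 0 by rewrite -unitfE -unitmxE.
have near_unit : \forall k \near F, (\det (f k))^-1 *: \adj (f k) = invmx (f k).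
  near=> k.
  have dk : \det (f k) != 0 by near: k; exact: cvgr_neq0 detf dA0.
  by rewrite /invmx unitmxE unitfE dk.
apply: cvg_trans; first exact: (near_eq_cvg near_unit).
rewrite /invmx uA; apply: cvgZ; first exact: cvgV.
apply: cvg_mxP => i j; rewrite mxE.
under [X in X @ _ --> _]eq_fun do rewrite mxE.
apply: cvgM; first exact: cvg_cst.
apply: cvg_det; apply: cvg_mxP => a b; rewrite !mxE.
under [X in X @ _ --> _]eq_fun do rewrite !mxE.
exact: cvg_coord.
Unshelve. all: by end_near. Qed.

Lemma cvg_col_mx m1 m2 n (f : I -> 'M[R]_(m1, n)) (g : I -> 'M[R]_(m2, n))
    (A : 'M[R]_(m1, n)) (B : 'M[R]_(m2, n)) :
  f @ F --> A -> g @ F --> B -> (fun k => col_mx (f k) (g k)) @ F --> col_mx A B.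
Proof.
move=> fA gB; apply: cvg_mxP => i j; rewrite mxE.
under [X in X @ _ --> _]eq_fun do rewrite mxE.
by case: (fintype.split i) => k; exact: cvg_coord.
Qed.

Lemma cvg_row_mx m n1 n2 (f : I -> 'M[R]_(m, n1)) (g : I -> 'M[R]_(m, n2))
    (A : 'M[R]_(m, n1)) (B : 'M[R]_(m, n2)) :
  f @ F --> A -> g @ F --> B -> (fun k => row_mx (f k) (g k)) @ F --> row_mx A B.
Proof.
move=> fA gB; apply: cvg_mxP => i j; rewrite mxE.
under [X in X @ _ --> _]eq_fun do rewrite mxE.
by case: (fintype.split j) => k; exact: cvg_coord.
Qed.

Lemma cvg_usubmx m1 m2 n (f : I -> 'M[R]_(m1 + m2, n)) (A : 'M[R]_(m1 + m2, n)) :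
  f @ F --> A -> (fun k => usubmx (f k)) @ F --> usubmx A.
Proof.
move=> fA; apply: cvg_mxP => i j; rewrite mxE.
by under [X in X @ _ --> _]eq_fun do rewrite mxE; exact: cvg_coord.
Qed.

Lemma cvg_dsubmx m1 m2 n (f : I -> 'M[R]_(m1 + m2, n)) (A : 'M[R]_(m1 + m2, n)) :
  f @ F --> A -> (fun k => dsubmx (f k)) @ F --> dsubmx A.
Proof.
move=> fA; apply: cvg_mxP => i j; rewrite mxE.
by under [X in X @ _ --> _]eq_fun do rewrite mxE; exact: cvg_coord.
Qed.

End matrix_limits.

Lemma ultra_fmap (I J : Type) (F : set_system I) (g : I -> J) :
  UltraFilter F -> UltraFilter (g @ F).
Proof.
move=> FU; split=> [|G GF FG]; first exact: fmap_proper_filter.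
rewrite eqEsubset; split=> // P GP.
have [//|FNP] := in_ultra_setVsetC (g @^-1` P) FU.
have : G (P `&` ~` P) by apply: filterI => //; exact: FG.
by rewrite setICr => /filter_not_empty.
Qed.

Lemma ultra_cvg_compact (T : topologicalType) (I : Type) (F : set_system I)
    (FU : UltraFilter F) (K : set T) (f : I -> T) :
  compact K -> (\forall k \near F, K (f k)) -> exists2 l, K l & f @ F --> l.
Proof.
rewrite compact_ultra => cK fK; have [l [Kl fl]] := cK _ (ultra_fmap f FU) fK.
by exists l.
Qed.

(** Each entry converges along the ultrafilter, because a segment is compact. *)
Lemma ultra_cvg_bounded (R : realType) (I : Type) (F : set_system I)
    (FU : UltraFilter F) m n (f : I -> 'M[R]_(m, n)) (C : R) :
  (\forall k \near F, forall i j, `|f k i j| <= C) ->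
  exists A : 'M[R]_(m, n), f @ F --> A.
Proof.
move=> fC.
have lims i j : exists l : R, (fun k => f k i j) @ F --> l.
  have [|l _ fl] := ultra_cvg_compact (f := fun k => f k i j) FU (@segment_compact R (- C) C).
    by apply: filterS fC => k /(_ i j) /=; rewrite in_itv /= ler_norml.
  by exists l.
pose A := \matrix_(i, j) xget 0 [set l : R | (fun k => f k i j) @ F --> l].
exists A; apply: cvg_mxP => i j; rewrite mxE.
exact: (@xgetPex _ 0 [set l : R | (fun k => f k i j) @ F --> l] (lims i j)).
Qed.

(** * Convex open sets *)

Section convex_topology.
Variables (R : realType) (V : normedModType R).
Implicit Types (S : set V) (x y z : V).

(** [convex_set] with membership as a proposition and weights ranging over R. *)
Definition convex S := forall x y s,
  S x -> S y -> 0 <= s <= 1 -> S (s *: x + (1 - s) *: y).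

Lemma convex_setP S : convex_set (S : set (convex_lmodType V)) -> convex S.
Proof.
move=> cS x y s Sx Sy /andP[s0 s1].
have := cS x y (Itv01 s0 s1); rewrite !inE => /(_ Sx Sy).
by rewrite /conv.
Qed.

Lemma openP S x : open S -> S x ->
  exists2 r, 0 < r & forall y, `|x - y| < r -> S y.
Proof.
move=> oS Sx; have : nbhs x S by exact: open_nbhs_nbhs.
rewrite -nbhs_ballE => -[r /= r0 rS]; exists r => // y xy.
by apply: rS; rewrite -ball_normE.
Qed.

Lemma closureP S y : closure S y <->
  forall e, 0 < e -> exists2 y', S y' & `|y - y'| < e.
Proof.
split=> [clS e e0|clS B].
  have [y' [Sy' yy']] := clS _ (nbhsx_ballx y e e0).
  by exists y' => //; move: yy'; rewrite -ball_normE.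
rewrite -nbhs_ballE => -[e /= e0 eB]; have [y' Sy' yy'] := clS _ e0.
by exists y'; split=> //; apply: eB; rewrite -ball_normE.
Qed.

(** Pushing y to a nearby point y' of S displaces z by a multiple of y - y',
    small enough to keep it in the open set S, without changing the convex
    combination. *)
Lemma convex_open_closure S z y s : convex S -> open S -> S z -> closure S y ->
  0 < s <= 1 -> S (s *: z + (1 - s) *: y).
Proof.
move=> cS oS Sz /closureP clSy /andP[s0 s1].
have [r r0 rS] := openP oS Sz.
have [y' Sy' yy'] := clSy _ (mulr_gt0 s0 r0).
pose z' := z + (s^-1 * (1 - s)) *: (y - y').
have -> : s *: z + (1 - s) *: y = s *: z' + (1 - s) *: y'.
  rewrite /z' scalerDr scalerA mulrA divff ?gt_eqF// mul1r -addrA -scalerDr.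
  by rewrite subrK.
apply: cS => //; last by rewrite ltW.
apply: rS; rewrite /z' opprD addNKr normrN normrZ.
have s1' : 0 <= 1 - s by rewrite subr_ge0.
rewrite (@ger0_norm _ (s^-1 * _)) ?mulr_ge0 ?invr_ge0 ?(ltW s0)//.
rewrite -mulrA ltr_pdivrMl//.
by apply: le_lt_trans yy'; rewrite ler_piMl// gerBl ltW.
Qed.

(** Prolong the segment from a point z of S beyond y, to a point of the closure
    still close to y; then y is a convex combination of z, with positive weight,
    and of that point. *)
Lemma convex_open_int_closure S y e : convex S -> open S -> S !=set0 -> 0 < e ->
  (forall y', `|y - y'| < e -> closure S y') -> S y.
Proof.
move=> cS oS [z Sz] e0 clS.
pose d := e / (2 * (1 + `|y - z|)).
have n0 : 0 < 1 + `|y - z| by rewrite ltr_pwDl.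
have d0 : 0 < d by rewrite divr_gt0// mulr_gt0.
pose y' := y + d *: (y - z).
have cly' : closure S y'.
  apply: clS; rewrite opprD addNKr normrN normrZ gtr0_norm//.
  rewrite /d mulrAC ltr_pdivrMr ?mulr_gt0// ltr_pM2l//.
  have := normr_ge0 (y - z); lra.
have d1 : 0 < 1 + d by rewrite addr_gt0.
have -> : y = (d / (1 + d)) *: z + (1 - d / (1 + d)) *: y'.
  have -> : 1 - d / (1 + d) = (1 + d)^-1.
    by apply: (mulIf (lt0r_neq0 d1)); rewrite mulrBl mulfVK ?mulVf ?gt_eqF//; ring.
  rewrite [d / _]mulrC -scalerA -scalerDr /y' addrCA scalerBr.
  have -> : y + (d *: z + (d *: y - d *: z)) = (1 + d) *: y.
    by rewrite [X in y + X]addrC subrK scalerDl scale1r.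
  by rewrite scalerA mulVf ?scale1r// gt_eqF.
apply: convex_open_closure => //; rewrite divr_gt0//= ler_pdivrMr// mul1r.
by rewrite lerDr.
Qed.

(** The point x + t v is the midpoint of x, which is interior, and x + 2 t v. *)
Lemma closure_line S x v : convex S -> open S -> S x ->
  (forall t, closure S (x + t *: v)) -> forall t, S (x + t *: v).
Proof.
move=> cS oS Sx cl t.
have -> : x + t *: v = 2^-1 *: x + (1 - 2^-1) *: (x + (2 * t) *: v).
  rewrite scalerDr addrA -scalerDl scalerA [2^-1 + _]addrC subrK scale1r.
  by congr (_ + _ *: _); field.
by apply: convex_open_closure => //; lra.
Qed.

(** Radstrom's cancellation argument. Starting from b = 0, write y + b = c' + b'
    with c' in S and b' of norm less than e, and iterate: the mean of the points
    of S obtained in m + 1 steps differs from y by the last error divided by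
    m + 1. *)
Lemma convex_near_ball S x r e : convex S -> 0 < e ->
  (forall y, `|x - y| < r + e -> exists2 c, S c & `|y - c| < e) ->
  forall y, `|x - y| < r -> closure S y.
Proof.
move=> cS e0 near_S y xy.
have avg m : exists c b, [/\ S c, `|b| < e & m.+1%:R *: y = m.+1%:R *: c + b].
  elim: m => [|m [c [b [Sc be mE]]]].
    have [|c Sc yc] := near_S y; first by apply: lt_trans xy _; rewrite ltrDl.
    by exists c, (y - c); split=> //; rewrite !scale1r addrC subrK.
  have [|c' Sc' yc'] := near_S (y + b).
    rewrite opprD addrA; apply: le_lt_trans (ler_normB _ _) _.
    by rewrite ltrD.
  exists ((m.+1%:R / m.+2%:R) *: c + (1 - m.+1%:R / m.+2%:R) *: c').
  exists (y + b - c'); split=> //.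
    apply: cS => //; rewrite divr_ge0//= ler_pdivrMr ?ltr0n// mul1r ler_nat.
    exact: leqnSn.
  rewrite scalerDr !scalerA mulrBr mulr1 mulrCA divff ?pnatr_eq0// mulr1.
  have -> : m.+2%:R - m.+1%:R = 1 :> R by rewrite -natrB// subSnn.
  rewrite -[m.+2]addn1 natrD scalerDl !scale1r mE -!addrA; congr (_ + _).
  by rewrite [RHS]addrC addrA subrK addrC.
apply/closureP => d d0.
have [m me] : exists m : nat, e / d < m.+1%:R.
  exists (Num.truncn (e / d)); exact: truncnS_gt.
have [c [b [Sc be mE]]] := avg m; exists c => //.
have -> : y - c = m.+1%:R^-1 *: b.
  apply: (scalerI (_ : m.+1%:R != 0 :> R)); first by rewrite pnatr_eq0.
  rewrite scalerBr mE addrC addKr scalerA divff ?scale1r// pnatr_eq0//.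
rewrite normrZ gtr0_norm ?invr_gt0// ltr_pdivrMl// mulrC.
by move: me; rewrite ltr_pdivrMr// mulrC => /(lt_trans be); rewrite mulrC.
Qed.

End convex_topology.

(** * Propagation along elementary directions *)

Section coordinate_steps.
Variables (R : realType) (m n : nat).
Implicit Types (X Y : 'M[R]_(m, n)).

Lemma mx_norm_ltP X r : 0 < r -> `|X| < r <-> forall i j, `|X i j| < r.
Proof.
move=> r0; rewrite /Num.norm /= mx_normrE; split=> [/bigmax_ltP[_ Xr] i j|Xr].
  exact: (Xr (i, j)).
by apply/bigmax_ltP; split=> // -[i j] _; exact: Xr.
Qed.

Lemma mx_norm_leP X r : 0 <= r -> `|X| <= r <-> forall i j, `|X i j| <= r.
Proof.
move=> r0; rewrite /Num.norm /= mx_normrE; split=> [/bigmax_leP[_ Xr] i j|Xr].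
  exact: (Xr (i, j)).
by apply/bigmax_leP; split=> // -[i j] _; exact: Xr.
Qed.

Lemma ler_entry X i j : `|X i j| <= `|X|.
Proof. by have /(mx_norm_leP _ (normr_ge0 X)) := lexx `|X|. Qed.

Lemma mx_norm_delta i j : `|delta_mx i j : 'M[R]_(m, n)| <= 1.
Proof.
apply/mx_norm_leP => // a b; rewrite mxE.
by case: (_ && _); rewrite ?normr0 ?normr1.
Qed.

(** Induction on the number of entries in which X and Y differ: as balls are
    cubes, replacing one entry of X by that of Y stays inside. *)
Lemma coord_steps_ball (P : 'M[R]_(m, n) -> Prop) (x : 'M[R]_(m, n)) r :
  (forall X i j t, `|x - X| < r -> `|x - (X + t *: delta_mx i j)| < r ->
     P X -> P (X + t *: delta_mx i j)) ->
  forall X Y, `|x - X| < r -> `|x - Y| < r -> P X -> P Y.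
Proof.
move=> step X Y xX xY PX.
have r0 : 0 < r by exact: le_lt_trans xX.
have [k] := ubnP #|[set ij | X ij.1 ij.2 != Y ij.1 ij.2]%SET|.
elim: k X xX PX => // k IH X xX PX Xk.
have [XY|/set0Pn[[i j]]] := eqVneq [set ij | X ij.1 ij.2 != Y ij.1 ij.2]%SET finset.set0.
  suff <- : X = Y by [].
  apply/matrixP => i j; apply/eqP; apply: contraT => Xij.
  have : (i, j) \in [set ij | X ij.1 ij.2 != Y ij.1 ij.2]%SET by rewrite inE.
  by rewrite XY inE.
rewrite inE /= => Xij.
pose X' := X + (Y i j - X i j) *: delta_mx i j.
have X'E a b : X' a b = if (a, b) == (i, j) then Y a b else X a b.
  rewrite !mxE xpair_eqE; case: (eqVneq a i) => [->|]; last by rewrite mulr0 addr0.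
  by case: (eqVneq b j) => [->|]; rewrite ?mulr0 ?addr0 //= mulr1 addrC subrK.
have xX' : `|x - X'| < r.
  have subE (M : 'M[R]_(m, n)) a b : (x - M) a b = x a b - M a b by rewrite !mxE.
  apply/mx_norm_ltP => // a b.
  move: xX xY => /(mx_norm_ltP _ r0)/(_ a b) + /(mx_norm_ltP _ r0)/(_ a b).
  by rewrite !subE X'E; case: ifP.
apply: (IH X') => //; first exact: step.
rewrite ltnS in Xk; apply: leq_trans Xk; apply: proper_card; apply/properP; split.
  by apply/fintype.subsetP => -[a b]; rewrite !inE /= X'E; case: ifP => //; rewrite eqxx.
by exists (i, j); rewrite !inE //= X'E eqxx eqxx.
Qed.

(** Balls of a common radius about the points of the segment from X0 to X are
    contained in S by convexity; finitely many of them link X0 to X. *)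
Lemma coord_steps (S : set 'M[R]_(m, n)) (P : 'M[R]_(m, n) -> Prop) X0 :
  convex S -> open S -> S X0 -> P X0 ->
  (forall X i j t, S X -> S (X + t *: delta_mx i j) ->
     P X -> P (X + t *: delta_mx i j)) ->
  forall X, S X -> P X.
Proof.
move=> cS oS SX0 PX0 step X SX.
have [r0 r0gt0 ball0] := openP oS SX0; have [r1 r1gt0 ball1] := openP oS SX.
(* N.+1 steps of length less than r cover the segment. *)
pose r := Num.min r0 r1; have rgt0 : 0 < r by rewrite lt_min r0gt0.
pose N := Num.truncn (`|X - X0| / r); pose Z k := X0 + (k%:R / N.+1%:R) *: (X - X0).
have ballZ k : (k <= N.+1)%N -> forall Y, `|Z k - Y| < r -> S Y.
  move=> kN Y; set v := Z k - Y; rewrite lt_min => /andP[vr0 vr1].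
  have -> : Y = (k%:R / N.+1%:R) *: (X - v) + (1 - k%:R / N.+1%:R) *: (X0 - v).
    have -> : Y = Z k - v by rewrite /v opprB addrC subrK.
    rewrite /Z; set s := k%:R / _; apply/matrixP => a b; rewrite !mxE; ring.
  apply: cS; first by apply: ball1; rewrite opprB addrC subrK.
    by apply: ball0; rewrite opprB addrC subrK.
  by rewrite divr_ge0//= ler_pdivrMr ?ltr0n// mul1r ler_nat.
suff PZ k : (k <= N.+1)%N -> P (Z k).
  by have := PZ _ (leqnn _); rewrite /Z divff ?pnatr_eq0// scale1r addrC subrK.
elim: k => [_|k IH kN]; first by rewrite /Z mul0r scale0r addr0.
apply: (@coord_steps_ball _ (Z k) r _ (Z k)) (IH (ltnW kN)).
- by move=> Y i j t Yr Y'r PY; apply: step PY; apply: (ballZ k (ltnW kN)).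
- by rewrite subrr normr0.
have -> : Z k - Z k.+1 = - N.+1%:R^-1 *: (X - X0).
  by apply/matrixP => a b; rewrite /Z !mxE -[k.+1%:R]natr1; ring.
rewrite normrZ normrN gtr0_norm ?invr_gt0 ?ltr0n//.
rewrite ltr_pdivrMl ?ltr0n// -ltr_pdivrMr//; exact: truncnS_gt.
Qed.

End coordinate_steps.

(** * Fractional linear maps in an affine chart *)

Section fractional_maps.
Variables (R : realType) (p q : nat).
Implicit Types (G H : 'M[R]_(p + q)) (X Y Z : 'M[R]_(q, p)).

(** With G in blocks a, b, c, d, [den G X] is a + b X and [num G X] is c + d X. *)
Definition den G X : 'M[R]_p := usubmx (G *m col_mx 1%:M X).
Definition num G X : 'M[R]_(q, p) := dsubmx (G *m col_mx 1%:M X).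

(** The graph of X is sent by G to the graph of Y. As a relation, this does not
    presuppose that the image of the graph of X lies in the chart. *)
Definition frac G X Y := num G X = Y *m den G X.

Lemma denE G X : den G X = ulsubmx G + ursubmx G *m X.
Proof.
by rewrite /den -[in LHS](submxK G) mul_block_col col_mxKu mulmx1.
Qed.

Lemma numE G X : num G X = dlsubmx G + drsubmx G *m X.
Proof.
by rewrite /num -[in LHS](submxK G) mul_block_col col_mxKd mulmx1.
Qed.

Lemma fracP G X Y :
  frac G X Y <-> exists T, G *m col_mx 1%:M X = col_mx 1%:M Y *m T.
Proof.
split=> [XY|[T XYT]].
  exists (den G X); rewrite mul_col_mx mul1mx -XY.
  by rewrite /den /num vsubmxK.
by rewrite /frac /num /den XYT mul_col_mx mul1mx col_mxKu col_mxKd.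
Qed.

Lemma frac_den G X Y : frac G X Y ->
  G *m col_mx 1%:M X = col_mx 1%:M Y *m den G X.
Proof. by rewrite mul_col_mx mul1mx => <-; rewrite /den /num vsubmxK. Qed.

(** Apply the inverse of G to G (1; X) = (1; Y) T and read off the upper block.
    In particular the denominator is invertible as soon as the image lies in
    the chart. *)
Lemma frac_den_inv G X Y : G \in unitmx -> frac G X Y ->
  den (invmx G) Y *m den G X = 1%:M.
Proof.
move=> uG XY; have := congr1 (mulmx (invmx G)) (frac_den XY).
rewrite mulKmx// => E.
have := congr1 usubmx E; rewrite col_mxKu mulmxA -[X in _ = usubmx (X *m _)]vsubmxK.
by rewrite mul_col_mx col_mxKu.
Qed.

Lemma frac_den_unit G X Y : G \in unitmx -> frac G X Y -> den G X \in unitmx.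
Proof. by move=> uG /(frac_den_inv uG)/mulmx1_unit[]. Qed.

Lemma frac_inv G X Y : G \in unitmx -> frac G X Y -> frac (invmx G) Y X.
Proof.
move=> uG XY; have uT := frac_den_unit uG XY; apply/fracP.
exists (invmx (den G X)).
by rewrite -[LHS](mulmxK uT) -[_ *m col_mx _ Y *m _]mulmxA -(frac_den XY) mulKmx.
Qed.

Lemma frac_comp G H X Y Z : frac G X Y -> frac H Y Z -> frac (H *m G) X Z.
Proof.
move=> /fracP[T1 E1] /fracP[T2 E2]; apply/fracP; exists (T2 *m T1).
by rewrite -mulmxA E1 mulmxA E2 mulmxA.
Qed.

Lemma frac_fun G X : den G X \in unitmx -> frac G X (num G X *m invmx (den G X)).
Proof. by move=> uT; rewrite /frac mulmxKV. Qed.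

Lemma frac_inj G X Y Y' : G \in unitmx -> frac G X Y -> frac G X Y' -> Y = Y'.
Proof.
move=> uG XY XY'; have uT := frac_den_unit uG XY.
by apply: (can_inj (mulmxK uT)); rewrite -XY -XY'.
Qed.

Lemma frac_eq G X Y : G \in unitmx -> frac G X Y ->
  Y = num G X *m invmx (den G X).
Proof.
by move=> uG XY; apply: (frac_inj uG XY); apply: frac_fun; exact: frac_den_unit XY.
Qed.

Lemma denZ c G X : den (c *: G) X = c *: den G X.
Proof. by rewrite /den -scalemxAl linearZ. Qed.

Lemma frac_scale c G X Y : frac G X Y -> frac (c *: G) X Y.
Proof.
have numZ : num (c *: G) X = c *: num G X by rewrite /num -scalemxAl linearZ.
by rewrite /frac denZ numZ => ->; rewrite scalemxAr.
Qed.

Definition transl Z : 'M[R]_(p + q) := block_mx 1%:M 0 Z 1%:M.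

Lemma frac_transl X Z : frac (transl Z) X (X + Z).
Proof.
apply/fracP; exists 1%:M; rewrite mulmx1 mul_block_col !mul1mx mul0mx addr0.
by rewrite mulmx1 addrC.
Qed.

Lemma mul_transl Y Z : transl Y *m transl Z = transl (Y + Z).
Proof.
by rewrite mulmx_block !mul1mx !mulmx1 !mul0mx !mulmx0 !addr0 !add0r.
Qed.

Lemma transl0 : transl 0 = 1%:M.
Proof. by rewrite /transl -scalar_mx_block. Qed.

Lemma transl_unit Z : transl Z \in unitmx.
Proof.
have : transl Z *m transl (- Z) = 1%:M by rewrite mul_transl subrr transl0.
by case/mulmx1_unit.
Qed.

Lemma den_transl_l Z G X : den (transl Z *m G) X = den G X.
Proof.
rewrite /den -mulmxA -[X in transl Z *m X]vsubmxK mul_block_col col_mxKu.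
by rewrite mul1mx mul0mx addr0.
Qed.

Lemma den_transl_r Z G X : den (G *m transl Z) X = den G (X + Z).
Proof.
rewrite /den -mulmxA mul_block_col !mul1mx mul0mx addr0 mulmx1.
by rewrite [Z + X]addrC.
Qed.

Lemma invmx_left n (A B : 'M[R]_n) : B *m A = 1%:M -> invmx A = B.
Proof. by move=> BA; have [_ uA] := mulmx1_unit BA; rewrite -[RHS](mulmxK uA) BA mul1mx. Qed.

(** Adding a multiple of an elementary matrix to X only changes column j of
    a + b X; expand the determinant along that column. *)
Lemma det_den_affine G X i j : exists c, forall t,
  \det (den G (X + t *: delta_mx i j)) = \det (den G X) + c * t.
Proof.
pose A := den G X; pose B := ursubmx G *m (delta_mx i j : 'M[R]_(q, p)).
have den_step t : den G (X + t *: delta_mx i j) = A + t *: B.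
  by rewrite /A !denE mulmxDr -scalemxAr addrA.
have B0 a b : b != j -> B a b = 0.
  move=> bj; rewrite mxE big1// => k _.
  by rewrite !mxE (negPf bj) andbF mulr0.
exists (\sum_a B a j * cofactor A a j) => t.
rewrite den_step (expand_det_col _ j) (expand_det_col A j) mulr_suml -big_split /=.
apply: eq_bigr => a _.
have -> : cofactor (A + t *: B) a j = cofactor A a j.
  rewrite /cofactor; congr (_ * \det _); apply/matrixP => k l.
  rewrite 3![LHS]mxE 2![RHS]mxE [X in _ + X]mxE.
  by rewrite B0 ?mulr0 ?addr0// eq_sym neq_lift.
by rewrite [(A + _) a j]mxE [(t *: B) a j]mxE; ring.
Qed.

Section limits.
Variables (I : Type) (F : set_system I).
Hypothesis FF : ProperFilter F.
Variables (G_ : I -> 'M[R]_(p + q)) (X_ Y_ : I -> 'M[R]_(q, p)).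

Lemma cvg_den G X : G_ @ F --> G -> X_ @ F --> X ->
  (fun k => den (G_ k) (X_ k)) @ F --> den G X.
Proof.
move=> GG XX; apply: cvg_usubmx; apply: cvg_mulmx => //.
by apply: cvg_col_mx => //; exact: cvg_cst.
Qed.

Lemma cvg_num G X : G_ @ F --> G -> X_ @ F --> X ->
  (fun k => num (G_ k) (X_ k)) @ F --> num G X.
Proof.
move=> GG XX; apply: cvg_dsubmx; apply: cvg_mulmx => //.
by apply: cvg_col_mx => //; exact: cvg_cst.
Qed.

Lemma cvg_frac_fun G X : G_ @ F --> G -> X_ @ F --> X ->
  den G X \in unitmx ->
  (fun k => num (G_ k) (X_ k) *m invmx (den (G_ k) (X_ k))) @ F
    --> num G X *m invmx (den G X).
Proof.
move=> GG XX uG; apply: cvg_mulmx; first exact: cvg_num.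
by apply: cvg_invmx => //; exact: cvg_den.
Qed.

Lemma cvg_frac G X Y : G_ @ F --> G -> X_ @ F --> X -> Y_ @ F --> Y ->
  (\forall k \near F, frac (G_ k) (X_ k) (Y_ k)) -> frac G X Y.
Proof.
move=> GG XX YY fr.
have numG := cvg_num GG XX; have denG := cvg_den GG XX.
apply: (cvg_unique _ numG); first exact: norm_hausdorff.
apply: (cvg_trans _ (cvg_mulmx FF YY denG)); apply: near_eq_cvg.
by apply: filterS fr => k ->.
Qed.

End limits.

(** The inverse of G is defined and continuous near Y. *)
Lemma frac_open G (S : set 'M[R]_(q, p)) X Y : G \in unitmx -> open S -> S X ->
  frac G X Y ->
  exists2 e, 0 < e & forall Y', `|Y - Y'| < e -> exists2 X', S X' & frac G X' Y'.
Proof.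
move=> uG oS SX XY; have YX := frac_inv uG XY.
have uV : invmx G \in unitmx by rewrite unitmx_inv.
have uT := frac_den_unit uV YX.
have cst : (fun _ : 'M[R]_(q, p) => invmx G : 'M[R]_(p + q)) @ nbhs Y -->
    (invmx G : 'M[R]_(p + q)) by apply: cvg_cst.
have cont := cvg_frac_fun (nbhs_pfilter Y) cst cvg_id uT.
have dcont : (fun Y' => \det (den (invmx G) Y')) @ Y --> \det (den (invmx G) Y).
  exact: (cvg_det (nbhs_pfilter Y) (cvg_den (nbhs_pfilter Y) cst cvg_id)).
have nS : nbhs (num (invmx G) Y *m invmx (den (invmx G) Y)) S.
  by rewrite -(frac_eq uV YX); exact: open_nbhs_nbhs.
have : \forall Y' \near Y, S (num (invmx G) Y' *m invmx (den (invmx G) Y')) /\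
   \det (den (invmx G) Y') != 0.
  near=> Y'; split; first by near: Y'; exact: cont nS.
  near: Y'; apply: cvgr_neq0 dcont _.
  by rewrite -unitfE -unitmxE.
move=> /nbhs_ballP[e /= e0 eS]; exists e => // Y' YY'.
have [|SX' uT'] := eS Y'; first by rewrite -ball_normE.
exists (num (invmx G) Y' *m invmx (den (invmx G) Y')) => //.
have uY' : den (invmx G) Y' \in unitmx by rewrite unitmxE unitfE.
by have := frac_inv uV (frac_fun uY'); rewrite invmxK.
Unshelve. all: by end_near. Qed.

End fractional_maps.

(** * Limits of maps between convergent domains *)

Section limits_of_domains.
Variables (R : realType) (p q : nat) (I : Type) (F : set_system I).
Implicit Types (S T : set 'M[R]_(q, p)) (G : 'M[R]_(p + q)) (X Y : 'M[R]_(q, p)).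

(** The uniform ball is what gives lower bounds on the size of the domains near
    a point that moves with the index. *)
Definition inner_limit (S_ : I -> set 'M[R]_(q, p)) S :=
  forall X, S X -> exists2 r, 0 < r &
    \forall k \near F, forall Y, `|X - Y| < r -> S_ k Y.

Definition outer_limit (S_ : I -> set 'M[R]_(q, p)) S :=
  forall (X_ : I -> 'M[R]_(q, p)) X, X_ @ F --> X ->
    (\forall k \near F, S_ k (X_ k)) -> closure S X.

Definition maps G S T := forall X, S X -> exists2 Y, T Y & frac G X Y.

(** The products v *m w are the matrices of rank one: these are the directions of
    the affine lines that come from projective lines in the Grassmannian. *)
Definition line_free S := forall X (v : 'cV[R]_q) (w : 'rV[R]_p),
  v != 0 -> w != 0 -> ~ forall t, S (X + t *: (v *m w)).

Lemma maps_comp G H S T (U : set 'M[R]_(q, p)) :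
  maps G S T -> maps H T U -> maps (H *m G) S U.
Proof.
move=> mG mH X /mG[Y /mH[Z UZ YZ] XY]; exists Z => //; exact: frac_comp XY YZ.
Qed.

Lemma affine_root (a b t : R) : a * (a + b * t) < 0 ->
  exists2 s, 0 <= s <= 1 & a + b * (s * t) = 0.
Proof.
move=> neg; have bt0 : b * t != 0.
  by apply: contraTneq neg => ->; rewrite addr0 -leNgt -expr2 sqr_ge0.
have sgn : a * (b * t) < 0.
  by apply: le_lt_trans neg; rewrite mulrDr -expr2 lerDr sqr_ge0.
have [b0 t0] : b != 0 /\ t != 0 by move: bt0; rewrite mulf_eq0 negb_or => /andP.
exists (- a / (b * t)); last by field; rewrite ?b0 ?t0.
have -> : - a / (b * t) = - (a * (b * t)) / (b * t) ^+ 2 by field; rewrite ?b0 ?t0.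
have sq : 0 < (b * t) ^+ 2 by rewrite lt0r sqr_ge0 expf_neq0.
rewrite divr_ge0 ?sqr_ge0 ?oppr_ge0 ?(ltW sgn)//= ler_pdivrMr// mul1r.
have := neg; rewrite mulrDr; nra.
Qed.

Hypothesis FF : ProperFilter F.

(** A nonzero limit determinant that vanished further along an elementary
    direction would change sign just beyond its zero, as it is affine there and
    the domain is open. Then the determinants of G_k have opposite signs at the
    two ends of a segment of S_k, so the one of G_k vanishes in between. *)
Lemma limit_den_neq0 (G_ : I -> 'M[R]_(p + q)) G (S_ : I -> set 'M[R]_(q, p)) S X0 :
  G_ @ F --> G -> convex S -> open S -> inner_limit S_ S ->
  (\forall k \near F, convex (S_ k)) ->
  (\forall k \near F, forall X, S_ k X -> \det (den (G_ k) X) != 0) ->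
  S X0 -> \det (den G X0) != 0 -> forall X, S X -> \det (den G X) != 0.
Proof.
move=> GG cS oS lowS cS_ nz SX0 nzX0.
apply: (coord_steps (P := fun X => \det (den G X) != 0)) SX0 nzX0 _ => //.
move=> X i j t SX SXt nzX; apply/negP => /eqP zXt.
have [c cE] := det_den_affine G X i j.
have [r r0 rS] := openP oS SXt.
(* The point of parameter t' lies beyond the zero and still in S. *)
pose d := r / (1 + `|t|) / 2; have t1 : 0 < 1 + `|t| by rewrite ltr_pwDl.
have d0 : 0 < d by rewrite !divr_gt0.
pose t' := (1 + d) * t.
have SXt' : S (X + t' *: delta_mx i j).
  apply: rS; have -> : X + t *: delta_mx i j - (X + t' *: delta_mx i j) = - (d * t) *: delta_mx i j.
    by apply/matrixP => a b; rewrite /t' !mxE; ring.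
  rewrite normrZ normrN; apply: le_lt_trans (_ : `|d * t| < r).
    by rewrite ler_piMr// mx_norm_delta.
  rewrite normrM gtr0_norm//.
  have -> : d * `|t| = r * (`|t| / (2 * (1 + `|t|))) by rewrite /d; field; rewrite lt0r_neq0.
  rewrite gtr_pMr// ltr_pdivrMr ?mulr_gt0// mul1r; have := normr_ge0 t; lra.
have neg : \det (den G X) * \det (den G (X + t' *: delta_mx i j)) < 0.
  rewrite cE; have : \det (den G X) + c * t = 0 by rewrite -cE.
  set a := \det _ in nzX * => E.
  have -> : a + c * t' = (1 + d) * (a + c * t) - d * a by rewrite /t'; ring.
  rewrite E mulr0 add0r -mulNr.
  by rewrite mulrCA -expr2 nmulr_rlt0 ?oppr_lt0// lt0r sqr_ge0 expf_neq0.
have lim X' : (fun k => \det (den (G_ k) X')) @ F --> \det (den G X').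
  by apply: cvg_det; apply: cvg_den => //; exact: cvg_cst.
have negF : \forall k \near F,
    \det (den (G_ k) X) * \det (den (G_ k) (X + t' *: delta_mx i j)) < 0.
  exact: cvgr_lt (cvgM (lim _) (lim _)) _ neg.
have [r1 r10 S1] := lowS _ SX; have [r2 r20 S2] := lowS _ SXt'.
have [k [[[[kneg kS1] kS2] kcS] knz]] :=
  filter_ex (filterI (filterI (filterI (filterI negF S1) S2) cS_) nz).
have [c' c'E] := det_den_affine (G_ k) X i j.
move: kneg; rewrite c'E => /affine_root[s s01]; rewrite -c'E.
apply/eqP/knz.
have -> : X + (s * t') *: delta_mx i j =
  s *: (X + t' *: delta_mx i j) + (1 - s) *: X.
  by apply/matrixP => a b; rewrite !mxE; ring.
by apply: kcS => //; [apply: kS2|apply: kS1]; rewrite subrr normr0.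
Qed.

(** The values of G are limits of values of G_k, so they lie in the closure of T.
    Since G is open, the closure of T contains a neighbourhood of each value. *)
Lemma limit_maps (G_ : I -> 'M[R]_(p + q)) G (S_ T_ : I -> set 'M[R]_(q, p)) S T X0 Y0 :
  G_ @ F --> G -> G \in unitmx -> (\forall k \near F, G_ k \in unitmx) ->
  convex S -> open S -> inner_limit S_ S -> (\forall k \near F, convex (S_ k)) ->
  convex T -> open T -> T !=set0 -> outer_limit T_ T ->
  (\forall k \near F, maps (G_ k) (S_ k) (T_ k)) ->
  S X0 -> frac G X0 Y0 -> maps G S T.
Proof.
move=> GG uG uG_ cS oS lowS cS_ cT oT T0 upT m_ SX0 X0Y0.
have unit_den X : S X -> den G X \in unitmx.
  have nz : \forall k \near F, forall X, S_ k X -> \det (den (G_ k) X) != 0.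
    near=> k => X' SX'; have : maps (G_ k) (S_ k) (T_ k) by near: k.
    move=> /(_ _ SX')[Y _ /frac_den_unit].
    by rewrite -unitfE -unitmxE; apply; near: k.
  rewrite unitmxE unitfE => SX.
  apply: (limit_den_neq0 GG cS oS lowS cS_ nz SX0 _ SX).
  by rewrite -unitfE -unitmxE; exact: frac_den_unit X0Y0.
have clT X Y : S X -> frac G X Y -> closure T Y.
  move=> SX XY; apply: (upT (fun k => num (G_ k) X *m invmx (den (G_ k) X))).
    rewrite (frac_eq uG XY); apply: cvg_frac_fun => //; first exact: cvg_cst.
    exact: unit_den.
  have [r r0 S1] := lowS _ SX.
  near=> k; have : maps (G_ k) (S_ k) (T_ k) by near: k.
  move=> /(_ X)[|Y' TY' XY'].
    by apply: (near S1 k) => //; rewrite subrr normr0.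
  by rewrite -(frac_eq _ XY')//; near: k.
move=> X SX; have XY := frac_fun (unit_den _ SX); move: (_ *m _) XY => Y XY.
exists Y => //; have [e e0 eS] := frac_open uG oS SX XY.
by apply: (convex_open_int_closure cT oT T0 e0) => Y' /eS[X' SX' /clT]; exact.
Unshelve. all: by end_near. Qed.

End limits_of_domains.

(** * The derivative at a fixed point *)

Section matrix_norm.
Variable R : realType.

Lemma mx_norm_mul m n r (A : 'M[R]_(m, n)) (B : 'M[R]_(n, r)) :
  `|A *m B| <= n%:R * (`|A| * `|B|).
Proof.
apply/mx_norm_leP => [|i j]; first by rewrite mulr_ge0// mulr_ge0.
rewrite mxE; apply: le_trans (ler_norm_sum _ _ _) _.
apply: le_trans (_ : \sum_(k < n) `|A| * `|B| <= _).
  by apply: ler_sum => k _; rewrite normrM ler_pM ?ler_entry.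
by rewrite sumr_const card_ord mulr_natl.
Qed.

Lemma mx_norm1 n : (0 < n)%N -> `|1%:M : 'M[R]_n| = 1.
Proof.
move=> n0; apply/eqP; rewrite eq_le; apply/andP; split.
  by apply/mx_norm_leP => // i j; rewrite mxE; case: (_ == _); rewrite ?normr1 ?normr0.
by have := ler_entry (1%:M : 'M[R]_n) (Ordinal n0) (Ordinal n0); rewrite mxE eqxx normr1.
Qed.

Lemma mx_norm_inv n (A : 'M[R]_n) : (0 < n)%N -> A \in unitmx ->
  1 <= n%:R * (`|A| * `|invmx A|).
Proof.
by move=> n0 uA; have := mx_norm_mul A (invmx A); rewrite mulmxV// mx_norm1.
Qed.

Lemma mx_norm_col m n (A : 'M[R]_(m, n)) : (0 < n)%N -> exists i, `|col i A| = `|A|.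
Proof.
move=> n0; have colA i : `|col i A| <= `|A|.
  by apply/mx_norm_leP => // k l; rewrite mxE ler_entry.
have [A0|A0] := eqVneq `|A| 0.
  by exists (Ordinal n0); apply/eqP; rewrite eq_le colA A0 normr_ge0.
have [[i j] Aij] := mx_norm_neq0 A0; exists j; apply/eqP; rewrite eq_le colA.
have := ler_entry (col j A) i 0; rewrite mxE.
by have -> : `|A| = `|A i j| by [].
Qed.

Lemma mx_norm_tr m n (A : 'M[R]_(m, n)) : `|A^T| = `|A|.
Proof.
by apply/eqP; rewrite eq_le; apply/andP; split; apply/mx_norm_leP => // i j;
  [rewrite mxE|have := ler_entry A^T j i; rewrite mxE]; rewrite ?ler_entry.
Qed.

Lemma mx_norm_row m n (A : 'M[R]_(m, n)) : (0 < m)%N -> exists i, `|row i A| = `|A|.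
Proof.
move=> m0; have [i iA] := mx_norm_col A^T m0; exists i.
by rewrite -mx_norm_tr tr_row iA mx_norm_tr.
Qed.

Lemma mx_norm_block m1 m2 n1 n2 (A : 'M[R]_(m1, n1)) (B : 'M[R]_(m1, n2))
    (C : 'M[R]_(m2, n1)) (D : 'M[R]_(m2, n2)) r : 0 <= r ->
  `|A| <= r -> `|B| <= r -> `|C| <= r -> `|D| <= r -> `|block_mx A B C D| <= r.
Proof.
move=> r0 Ar Br Cr Dr; apply/mx_norm_leP => // i j; rewrite mxE.
by case: (fintype.split i) => k; rewrite mxE; case: (fintype.split j) => l;
  apply: le_trans (ler_entry _ _ _) _.
Qed.

Lemma convex_line_segment (V : normedModType R) (T : set V) v s1 s2 s : convex T ->
  T (s1 *: v) -> T (s2 *: v) -> s1 <= s <= s2 -> s1 < s2 -> T (s *: v).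
Proof.
move=> cT T1 T2 /andP[ss1 ss2] s12; have d0 : 0 < s2 - s1 by rewrite subr_gt0.
have -> : s *: v = ((s2 - s) / (s2 - s1)) *: (s1 *: v) +
                   (1 - (s2 - s) / (s2 - s1)) *: (s2 *: v).
  by rewrite !scalerA -scalerDl; congr (_ *: _); field; rewrite gt_eqF.
apply: cT => //; rewrite divr_ge0 ?subr_ge0 ?(ltW s12)//=.
by rewrite ler_pdivrMr// mul1r lerB.
Qed.

End matrix_norm.

Section fixed_origin.
Variables (R : realType) (p q : nat).
Hypotheses (p0 : (0 < p)%N) (q0 : (0 < q)%N).
Implicit Types (H : 'M[R]_(p + q)).

(** A map fixing the origin has no constant term. *)
Lemma frac00_dl H : frac H 0 0 -> dlsubmx H = 0.
Proof.
rewrite /frac mul0mx /num -[in X in X -> _](submxK H) mul_block_col col_mxKd.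
by rewrite mulmx1 mulmx0 addr0.
Qed.

Lemma frac00_ul_unit H : H \in unitmx -> frac H 0 0 -> ulsubmx H \in unitmx.
Proof. by move=> uH /(frac_den_unit uH); rewrite denE mulmx0 addr0. Qed.

Lemma frac00_ul_inv H : H \in unitmx -> frac H 0 0 ->
  ulsubmx (invmx H) = invmx (ulsubmx H).
Proof.
move=> uH H00; have ua := frac00_ul_unit uH H00.
have := frac_den_inv uH H00; rewrite !denE !mulmx0 !addr0 => E.
by rewrite -[RHS]mul1mx -E mulmxK.
Qed.

Lemma frac00_dr_inv H : H \in unitmx -> frac H 0 0 ->
  drsubmx H \in unitmx /\ drsubmx (invmx H) = invmx (drsubmx H).
Proof.
move=> uH H00; have E : drsubmx (invmx H) *m drsubmx H = 1%:M.
  have := mulVmx uH; rewrite -[in X in X -> _](submxK (invmx H)) -[in X in _ *m X](submxK H).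
  rewrite mulmx_block (frac00_dl (frac_inv uH H00)) !mul0mx !add0r.
  by rewrite (scalar_mx_block p q) => /eq_block_mx[].
have [_ ud] := mulmx1_unit E; split=> //.
by rewrite -[RHS]mul1mx -E mulmxK.
Qed.

(** With E the elementary matrix at (i, j), the map sends t E to
    t / (1 + t nu) times d E a^-1, where nu is the entry (j, i) of a^-1 b. No
    pole occurs for t of absolute value less than r, which bounds nu by 1 / r;
    the images of r / 2 and - r / 2 then lie beyond r / 3 and - r / 3. The
    column v of d and the row w of a^-1 are chosen to be of maximal norm. *)
Lemma origin_bounds H (r : R) (T : set 'M[R]_(q, p)) : H \in unitmx -> frac H 0 0 ->
  0 < r -> convex T -> (forall X, `|X| < r -> exists2 Y, T Y & frac H X Y) ->
  `|invmx (ulsubmx H) *m ursubmx H| <= r^-1 /\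
  exists (v : 'cV[R]_q) (w : 'rV[R]_p), [/\ `|v| = `|drsubmx H|,
    `|w| = `|invmx (ulsubmx H)| &
    forall s, `|s| <= r / 3 -> T (s *: (v *m w))].
Proof.
move=> uH H00 r0 cT mH.
have ua := frac00_ul_unit uH H00; have dl0 := frac00_dl H00.
set a := ulsubmx H in ua *; set b := ursubmx H; set d := drsubmx H.
pose nu i j := (invmx a *m b) j i.
have sandwich (M : 'M[R]_(p, q)) i j :
    delta_mx i j *m M *m delta_mx i j = M j i *: (delta_mx i j : 'M[R]_(q, p)).
  rewrite -(mul_delta_mx (0 : 'I_1)) -!mulmxA [M *m _]mulmxA.
  rewrite [delta_mx 0 j *m _]mulmxA [delta_mx 0 j *m (M *m _)]mulmxA -rowE -colE.
  by rewrite [col i _]mx11_scalar mul_scalar_mx -scalemxAr !mxE.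
(* The projective formula: E a^-1 (a + t b E) = (1 + t nu) E. *)
have E_den i j t : delta_mx i j *m invmx a *m den H (t *: delta_mx i j) =
    (1 + t * nu i j) *: (delta_mx i j : 'M[R]_(q, p)).
  rewrite denE -/a -/b mulmxDr mulmxKV// -mulmxA -!scalemxAr scalerDl scale1r.
  congr (_ + _); rewrite -scalerA; congr (_ *: _).
  by rewrite [invmx a *m _]mulmxA [LHS]mulmxA sandwich.
have small i j t : `|t| < r -> `|t *: delta_mx i j : 'M[R]_(q, p)| < r.
  move=> tr; apply: le_lt_trans tr.
  by rewrite normrZ ler_piMr// mx_norm_delta.
(* At a pole E a^-1 would be killed by an invertible denominator. *)
have nu_neq i j t : `|t| < r -> 1 + t * nu i j != 0.
  move=> tr; apply/negP => /eqP nu0; have [Y _ XY] := mH _ (small i j t tr).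
  have := E_den i j t; rewrite nu0 scale0r.
  move=> /(congr1 (fun M => M *m invmx (den H (t *: delta_mx i j)) *m a)).
  rewrite mulmxK ?(frac_den_unit uH XY)// mulmxKV// !mul0mx => /matrixP/(_ i j).
  by rewrite !mxE !eqxx => /eqP; rewrite oner_eq0.
have line i j t : `|t| < r ->
    T ((t / (1 + t * nu i j)) *: (d *m delta_mx i j *m invmx a)).
  move=> tr; have [Y TY XY] := mH _ (small i j t tr).
  suff <- : Y = (t / (1 + t * nu i j)) *: (d *m delta_mx i j *m invmx a) by [].
  apply: (can_inj (mulmxK (frac_den_unit uH XY))); rewrite -XY numE dl0 add0r.
  rewrite -scalemxAl -[d *m _ *m _]mulmxA -[d *m _ *m _]mulmxA E_den -!scalemxAr.
  by rewrite scalerA divfK// nu_neq.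
(* Otherwise t = - 1 / nu is a pole inside the ball. *)
have nu_le i j : `|nu i j| <= r^-1.
  rewrite leNgt; apply/negP => nur.
  have nu0 : nu i j != 0 by rewrite -normr_gt0 (lt_trans _ nur)// invr_gt0.
  have /(nu_neq i j)/eqP : `|- (nu i j)^-1| < r.
    by rewrite normrN normfV -[r]invrK ltf_pV2 ?posrE ?invr_gt0 ?normr_gt0.
  by case; rewrite mulNr mulVf// subrr.
split; first by apply/mx_norm_leP => [|j i]; [rewrite invr_ge0 ltW|exact: nu_le].
have [i iE] := mx_norm_col d q0; have [j jE] := mx_norm_row (invmx a) p0.
exists (col i d), (row j (invmx a)); split=> // s sr.
have -> : col i d *m row j (invmx a) = d *m delta_mx i j *m invmx a.
  by rewrite colE rowE -(mul_delta_mx (0 : 'I_1) i j) !mulmxA.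
have rh : `|r / 2| < r by rewrite gtr0_norm ?divr_gt0// ltr_pdivrMr// ltr_pMr// ltr1n.
have rhN : `|- (r / 2)| < r by rewrite normrN.
have := nu_le i j; rewrite ler_norml -(ler_pM2l r0) -[_ <= r^-1](ler_pM2l r0).
rewrite mulrN divff ?gt_eqF// => /andP[nu1 nu2].
(* Both denominators lie between 1/2 and 3/2. *)
have c1 : 0 < 1 + r / 2 * nu i j by lra.
have c2 : 0 < 1 + - (r / 2) * nu i j by lra.
move: sr; rewrite ler_norml => /andP[s1 s2].
apply: (convex_line_segment cT (line i j _ rhN) (line i j _ rh)).
  apply/andP; split.
    rewrite ler_pdivrMr//; nra.
  rewrite ler_pdivlMr//; nra.
by rewrite mulNr (lt_trans (_ : _ < 0)) ?oppr_lt0 ?divr_gt0.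
Qed.

End fixed_origin.

(** * Compactness of equivalences between convergent domains *)

Section domains_limit.
Variables (R : realType) (p q : nat) (I : Type) (F : set_system I).
Hypotheses (p0 : (0 < p)%N) (q0 : (0 < q)%N) (FU : UltraFilter F).
Implicit Types (S T : set 'M[R]_(q, p)) (G H : 'M[R]_(p + q)).

(** Along an ultrafilter, a property that does not hold eventually fails
    eventually. *)
Lemma ultra_bounded (P : I -> R -> Prop) :
  ~ (forall C, \forall k \near F, ~ P k C) ->
  exists C, \forall k \near F, P k C.
Proof.
move=> nP; apply: contrapT => /forallNP nC; apply: nP => C.
by have [/nC|] := in_ultra_setVsetC [set k | P k C] FU.
Qed.

Lemma near_choice (T : pointedType) (P : I -> T -> Prop) :
  (\forall k \near F, exists x, P k x) ->
  exists f, \forall k \near F, P k (f k).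
Proof.
move=> nP; exists (fun k => xget point (P k)); apply: filterS nP => k Pk.
exact: (xgetPex point Pk).
Qed.

Lemma ultra_cvg_unit m n (v : I -> 'M[R]_(m, n)) :
  (\forall k \near F, v k != 0) ->
  exists2 l : 'M[R]_(m, n), (fun k => `|v k|^-1 *: v k) @ F --> l & l != 0.
Proof.
move=> v0; have n1 : \forall k \near F, `| `|v k|^-1 *: v k| = 1.
  apply: filterS v0 => k vk; rewrite normrZ normfV normr_id mulVf//.
  by rewrite normr_eq0.
have [|l vl] := @ultra_cvg_bounded R I F FU m n (fun k => `|v k|^-1 *: v k) 1.
  apply: filterS n1 => k vk i j; by rewrite (le_trans (ler_entry _ _ _))// vk.
exists l => //; apply: contraPneq vl => -> vl0.
have lt1 : \forall k \near F, `|0 - `|v k|^-1 *: v k| < 1.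
  exact: cvgr_dist_lt vl0 _ ltr01.
have [k [/= + vk]] := filter_ex (filterI lt1 n1).
by rewrite sub0r normrN vk ltxx.
Qed.

(** Suppose that the products |v_k| |w_k| are unbounded, with v_k, w_k the
    vectors given by [origin_bounds]. Along the ultrafilter their directions converge to
    nonzero v and w, and the segments of length proportional to |v_k| |w_k|
    through y_k eventually contain every y_k + t v_k w_k / (|v_k| |w_k|). In the
    limit T contains the line through y in the direction v w. *)
Lemma derivative_bound (H_ : I -> 'M[R]_(p + q)) (S_ T_ : I -> set 'M[R]_(q, p)) T
    (x_ y_ : I -> 'M[R]_(q, p)) y r :
  0 < r ->
  (\forall k \near F, H_ k \in unitmx) ->
  (\forall k \near F, frac (H_ k) 0 0) ->
  (\forall k \near F, forall X, `|X| < r -> S_ k (X + x_ k)) ->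
  (\forall k \near F, convex (T_ k)) ->
  (\forall k \near F, forall X, S_ k (X + x_ k) ->
     exists2 Y, T_ k (Y + y_ k) & frac (H_ k) X Y) ->
  y_ @ F --> y -> T y -> convex T -> open T -> outer_limit F T_ T -> line_free T ->
  exists C, \forall k \near F,
    `|invmx (ulsubmx (H_ k)) *m ursubmx (H_ k)| <= C /\
    `|drsubmx (H_ k)| * `|invmx (ulsubmx (H_ k))| <= C.
Proof.
move=> r0 uH H00 ballS cT_ mH yy Ty cT oT upT noline.
have shift_convex U (z : 'M[R]_(q, p)) : convex U -> convex [set Y | U (Y + z)].
  move=> cU Y Y' s UY UY' s01 /=; have := cU _ _ s UY UY' s01.
  by congr U; apply/matrixP => a b; rewrite !mxE; ring.
have bnds : \forall k \near F, `|invmx (ulsubmx (H_ k)) *m ursubmx (H_ k)| <= r^-1 /\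
    exists vw : 'cV[R]_q * 'rV[R]_p, [/\ `|vw.1| = `|drsubmx (H_ k)|,
    `|vw.2| = `|invmx (ulsubmx (H_ k))| &
    forall s, `|s| <= r / 3 -> T_ k (s *: (vw.1 *m vw.2) + y_ k)].
  near=> k.
  have [||||X Xr|-> [v [w [vE wE vw]]]] :=
      @origin_bounds R p q p0 q0 (H_ k) r [set Y | T_ k (Y + y_ k)].
  - by near: k.
  - by near: k.
  - by [].
  - by apply: shift_convex; near: k.
  - apply: (near mH k) => //; exact: (near ballS k).
  by split=> //; exists (v, w).
have [|C bC] := @ultra_bounded
  (fun k C => `|drsubmx (H_ k)| * `|invmx (ulsubmx (H_ k))| <= C).
  move=> large.
  have [vw vwP] := near_choice (filterS (fun k => @proj2 _ _) bnds).
  have prod_gt C : 0 <= C -> \forall k \near F, C < `|(vw k).1| * `|(vw k).2|.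
    move=> C0; apply: filterS (filterI (large C) vwP) => k [/negP].
    by rewrite -ltNge => lt [-> -> _].
  have [v vv v0] : exists2 v : 'cV[R]_q,
      (fun k => `|(vw k).1|^-1 *: (vw k).1) @ F --> v & v != 0.
    apply: ultra_cvg_unit; apply: filterS (prod_gt 0 (lexx 0)) => k.
    by apply: contraTneq => ->; rewrite normr0 mul0r ltxx.
  have [w ww w0] : exists2 w : 'rV[R]_p,
      (fun k => `|(vw k).2|^-1 *: (vw k).2) @ F --> w & w != 0.
    apply: ultra_cvg_unit; apply: filterS (prod_gt 0 (lexx 0)) => k.
    by apply: contraTneq => ->; rewrite normr0 mulr0 ltxx.
  apply: (noline y v w) => //; apply: closure_line => // t.
  apply: (upT (fun k => y_ k + t *: ((`|(vw k).1|^-1 *: (vw k).1) *m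
                                     (`|(vw k).2|^-1 *: (vw k).2)))).
    by apply: cvgD => //; apply: cvgZ; [exact: cvg_cst|exact: cvg_mulmx].
  have C0 : 0 <= `|t| * 3 / r by rewrite divr_ge0// ?mulr_ge0// ltW.
  apply: filterS (filterI vwP (prod_gt _ C0)) => k [[_ _ seg] tP].
  set P := `|_| * `|_| in tP.
  have P0 : 0 < P := le_lt_trans C0 tP.
  rewrite addrC -scalemxAl -scalemxAr !scalerA.
  apply: seg; rewrite -mulrA -invfM normrM normfV (gtr0_norm P0).
  by move: tP; rewrite ltr_pdivrMr// ler_pdivrMr// => tP; lra.
exists (Num.max r^-1 C); near=> k; split.
  by rewrite le_max; apply/orP; left; near: k; apply: filterS bnds => k [].
by rewrite le_max; apply/orP; right; near: k.
Unshelve. all: by end_near. Qed.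

(** Here a, a', d, d' are the norms of two blocks and of their inverses. Scaling
    G by a constant changes a and d but neither product d a' nor d' a, so one
    normalisation, a = 1, turns the bounds on products into bounds on each
    factor. *)
Lemma conjugate_bounds (a a' d d' : R) (m n : nat) (C : R) :
  0 <= a' -> 0 <= d -> 0 <= d' ->
  a = 1 -> d * a' <= C -> d' * a <= C -> 1 <= m%:R * (a * a') ->
  1 <= n%:R * (d * d') ->
  [/\ a' <= n%:R * C * C, d <= m%:R * C & d' <= C].
Proof.
move=> a'0 d0 d'0 -> da' d'a ma nd; rewrite mulr1 in d'a; rewrite mul1r in ma.
have C0 : 0 <= C by exact: le_trans d'a.
have m0 : 0 <= m%:R :> R by []; have n0 : 0 <= n%:R :> R by [].
split=> //.
  apply: le_trans (_ : n%:R * (d * d') * a' <= _); first by rewrite ler_peMl.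
  by rewrite -!mulrA ler_wpM2l// [d' * a']mulrC mulrA ler_pM// mulr_ge0.
apply: le_trans (_ : m%:R * a' * d <= _); first by rewrite ler_peMl.
by rewrite -mulrA ler_wpM2l// mulrC.
Qed.

(** The hypotheses are symmetric in S and T under inversion, so the bounds and the
    passage to the limit are used once for G_k and once for its inverse. Bounding
    the inverses as well makes the limit invertible. *)
Theorem limit_of_equivalences (G_ : I -> 'M[R]_(p + q))
    (S_ T_ : I -> set 'M[R]_(q, p)) S T (x_ y_ : I -> 'M[R]_(q, p)) x y :
  convex S -> open S -> line_free S -> (\forall k \near F, convex (S_ k)) ->
  inner_limit F S_ S -> outer_limit F S_ S ->
  convex T -> open T -> line_free T -> (\forall k \near F, convex (T_ k)) ->
  inner_limit F T_ T -> outer_limit F T_ T ->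
  (\forall k \near F, G_ k \in unitmx) ->
  (\forall k \near F, maps (G_ k) (S_ k) (T_ k)) ->
  (\forall k \near F, maps (invmx (G_ k)) (T_ k) (S_ k)) ->
  x_ @ F --> x -> y_ @ F --> y -> S x -> T y ->
  (\forall k \near F, frac (G_ k) (x_ k) (y_ k)) ->
  exists2 G : 'M[R]_(p + q), G \in unitmx & maps G S T /\ maps (invmx G) T S.
Proof.
move=> cS oS lS cS_ iS uS cT oT lT cT_ iT uT uG mG mG' xx yy Sx Ty xy.
(* Scaling acts trivially on the chart, so the upper left block of H_ below can
   be given norm 1. *)
wlog norm1 : G_ uG mG mG' xy / \forall k \near F, `|den (G_ k) (x_ k)| = 1.
  move=> normalised; pose c k := `|den (G_ k) (x_ k)|^-1.
  have c0 : \forall k \near F, c k != 0.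
    apply: filterS (filterI uG xy) => k [uGk xyk].
    rewrite invr_eq0; apply: contraTneq (mx_norm_inv p0 (frac_den_unit uGk xyk)) => ->.
    by rewrite mul0r mulr0 ler10.
  apply: (normalised (fun k => c k *: G_ k)).
  - by apply: filterS (filterI uG c0) => k [uGk ck]; rewrite unitmxZ ?unitfE.
  - by apply: filterS mG => k m X /m[Y TY XY]; exists Y => //; exact: frac_scale.
  - apply: filterS (filterI (filterI mG' c0) uG) => k [[m ck] uGk] X /m[Y TY XY].
    by exists Y => //; rewrite invmxZ ?unitmxZ ?unitfE//; exact: frac_scale.
  - by apply: filterS xy => k; exact: frac_scale.
  - apply: filterS c0 => k ck; rewrite denZ normrZ /c normfV normr_id mulVf//.
    by rewrite -invr_eq0.
(* The conjugate of G_ k that fixes the origin. *)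
pose H_ k := transl (- y_ k) *m G_ k *m transl (x_ k).
have uH : \forall k \near F, H_ k \in unitmx.
  by apply: filterS uG => k uGk; rewrite !unitmx_mul !transl_unit uGk.
have invH : \forall k \near F,
    invmx (H_ k) = transl (- x_ k) *m invmx (G_ k) *m transl (y_ k).
  apply: filterS uG => k uGk; apply: invmx_left.
  rewrite /H_ -!mulmxA [transl (y_ k) *m _]mulmxA mul_transl subrr transl0 mul1mx.
  by rewrite [invmx _ *m _]mulmxA mulVmx// mul1mx mul_transl addNr transl0.
have conj G x' y' X Y : frac G (X + x') (Y + y') ->
    frac (transl (- y') *m G *m transl x') X Y.
  move=> fG; rewrite -mulmxA; apply: (frac_comp (Y := Y + y')).
    exact: frac_comp (frac_transl _ _) fG.
  by rewrite -[X in frac _ _ X](addrK y' Y); exact: frac_transl.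
have H00 : \forall k \near F, frac (H_ k) 0 0.
  by apply: filterS xy => k xyk; apply: conj; rewrite !add0r.
have uH' : \forall k \near F, invmx (H_ k) \in unitmx.
  by apply: filterS uH => k; rewrite unitmx_inv.
have H00' : \forall k \near F, frac (invmx (H_ k)) 0 0.
  by apply: filterS (filterI uH H00) => k [uHk]; exact: frac_inv.
have shifted (U_ : I -> set 'M[R]_(q, p)) U (z_ : I -> 'M[R]_(q, p)) z :
    inner_limit F U_ U -> z_ @ F --> z -> U z ->
    exists2 r, 0 < r & \forall k \near F, forall X, `|X| < r -> U_ k (X + z_ k).
  move=> iU zz Uz; have [r r0 rU] := iU _ Uz; exists (r / 2); first by rewrite divr_gt0.
  have zr : \forall k \near F, `|z - z_ k| < r / 2.
    by apply: cvgr_dist_lt zz _ _; rewrite divr_gt0.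
  apply: filterS (filterI rU zr) => k [kU kz] X Xr; apply: kU.
  rewrite opprD addrCA addrC; apply: le_lt_trans (ler_normB _ _) _; lra.
have [r r0 rS] := shifted _ _ _ _ iS xx Sx.
have [r' r'0 rT] := shifted _ _ _ _ iT yy Ty.
have mH : \forall k \near F, forall X, S_ k (X + x_ k) ->
    exists2 Y, T_ k (Y + y_ k) & frac (H_ k) X Y.
  apply: filterS mG => k m X /m[Y TY XY]; exists (Y - y_ k); rewrite ?subrK//.
  by apply: conj; rewrite subrK.
have mH' : \forall k \near F, forall Y, T_ k (Y + y_ k) ->
    exists2 X, S_ k (X + x_ k) & frac (invmx (H_ k)) Y X.
  apply: filterS (filterI invH mG') => k [-> m] Y /m[X SX YX].
  by exists (X - x_ k); rewrite ?subrK//; apply: conj; rewrite subrK.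
have [C1 bH] := derivative_bound r0 uH H00 rS cT_ mH yy Ty cT oT uT lT.
have [C2 bH'] := derivative_bound r'0 uH' H00' rT cS_ mH' xx Sx cS oS uS lS.
pose C := Num.max 0 (Num.max C1 C2).
have C0 : 0 <= C by rewrite le_max lexx.
have C1C : C1 <= C by rewrite !le_max lexx !orbT.
have C2C : C2 <= C by rewrite !le_max lexx !orbT.
(* One constant dominating the bounds for all the blocks of H_ and its inverse. *)
pose K := 1 + q%:R * C * C + p%:R * C + C + p%:R * (1 * C) + p%:R * (q%:R * C * C * C).
have bounds : \forall k \near F, `|H_ k| <= K /\ `|invmx (H_ k)| <= K.
  near=> k.
  have uHk : H_ k \in unitmx by near: k.
  have Hk00 : frac (H_ k) 0 0 by near: k.
  have ua := frac00_ul_unit uHk Hk00.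
  have [ud dE] := frac00_dr_inv uHk Hk00.
  have aE := frac00_ul_inv uHk Hk00.
  have a1 : `|ulsubmx (H_ k)| = 1.
    have := den_transl_r (x_ k) (transl (- y_ k) *m G_ k) 0.
    rewrite denE mulmx0 addr0 add0r den_transl_l => ->.
    by near: k.
  have [b1 da] : `|invmx (ulsubmx (H_ k)) *m ursubmx (H_ k)| <= C1 /\
    `|drsubmx (H_ k)| * `|invmx (ulsubmx (H_ k))| <= C1 by near: k.
  have := near bH' k; rewrite aE dE invmxK => /(_ _)[//|b2 d'a].
  have [Ka' Kd Kd'] := conjugate_bounds (normr_ge0 _) (normr_ge0 _) (normr_ge0 _)
    a1 (le_trans da C1C) (le_trans d'a C2C) (mx_norm_inv p0 ua) (mx_norm_inv q0 ud).
  have qC : 0 <= q%:R * C * C by rewrite !mulr_ge0.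
  have pC : 0 <= p%:R * C by rewrite !mulr_ge0.
  have pC' : 0 <= p%:R * (1 * C) by rewrite !mulr_ge0.
  have pqC : 0 <= p%:R * (q%:R * C * C * C) by rewrite !mulr_ge0.
  have Kb : `|ursubmx (H_ k)| <= p%:R * (1 * C).
    rewrite -[ursubmx (H_ k)](mulKVmx ua); apply: le_trans (mx_norm_mul _ _) _.
    by rewrite a1 ler_wpM2l// ler_wpM2l// (le_trans b1).
  have Kb' : `|ursubmx (invmx (H_ k))| <= p%:R * (q%:R * C * C * C).
    rewrite -[ursubmx (invmx _)](mulKmx ua); apply: le_trans (mx_norm_mul _ _) _.
    by rewrite ler_wpM2l// ler_pM// (le_trans b2).
  split.
    rewrite -[H_ k]submxK (frac00_dl Hk00); apply: mx_norm_block; rewrite ?normr0 ?a1 /K; lra.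
  rewrite -[invmx (H_ k)]submxK (frac00_dl (frac_inv uHk Hk00)) aE dE.
  apply: mx_norm_block; rewrite ?normr0 /K; lra.
have [|H HH] := @ultra_cvg_bounded R I F FU _ _ H_ K.
  by apply: filterS bounds => k [b _] i j; exact: le_trans (ler_entry _ _ _) b.
have [|H' HH'] := @ultra_cvg_bounded R I F FU _ _ (fun k => invmx (H_ k)) K.
  by apply: filterS bounds => k [_ b] i j; exact: le_trans (ler_entry _ _ _) b.
have HV : H *m H' = 1%:M.
  apply: (cvg_unique _ (cvg_mulmx _ HH HH')); first exact: norm_hausdorff.
  apply: (cvg_trans _ (@cvg_cst _ (1%:M : 'M[R]_(p + q)) _ F _)); apply: near_eq_cvg.
  by apply: filterS uH => k /mulmxV.
have [uHlim _] := mulmx1_unit HV.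
have cvg_transl (z_ : I -> 'M[R]_(q, p)) (z : 'M[R]_(q, p)) : z_ @ F --> z ->
   (fun k => transl (z_ k)) @ F --> transl z.
  by move=> zz; apply: cvg_col_mx; apply: cvg_row_mx => //; exact: cvg_cst.
pose G := transl y *m H *m transl (- x).
have uGlim : G \in unitmx by rewrite !unitmx_mul !transl_unit uHlim.
have GG : G_ @ F --> G.
  have -> : G_ = fun k => transl (y_ k) *m H_ k *m transl (- x_ k).
    apply/funext => k; rewrite /H_ -!mulmxA mul_transl subrr transl0 mulmx1.
    by rewrite mulmxA mul_transl subrr transl0 mul1mx.
  apply: cvg_mulmx; last by apply: cvg_transl; exact: cvgN.
  by apply: cvg_mulmx => //; exact: cvg_transl.
have Gxy : frac G x y by exact: cvg_frac GG xx yy xy.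
exists G => //; split.
  apply: (limit_maps _ GG uGlim uG cS oS iS cS_ cT oT _ uT mG Sx Gxy).
  by exists y.
have uG' : \forall k \near F, invmx (G_ k) \in unitmx.
  by apply: filterS uG => k; rewrite unitmx_inv.
have uGlim' : invmx G \in unitmx by rewrite unitmx_inv.
have GG' : (fun k => invmx (G_ k)) @ F --> invmx G by exact: cvg_invmx.
apply: (limit_maps _ GG' uGlim' uG' cT oT iT cT_ cS oS _ uS mG' Ty (frac_inv uGlim Gxy)).
by exists x.
Unshelve. all: by end_near. Qed.

End domains_limit.

(** * Local Hausdorff convergence *)

Section hausdorff_limits.
Variables (R : realType) (m n : nat).
Implicit Types (A B : set 'M[R]_(m, n)) (X Y : 'M[R]_(m, n)).

Lemma mx_norm_le_eucl X : `|X| <= eucl_norm X.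
Proof.
apply/mx_norm_leP => [|i j]; first exact: sqrtr_ge0.
rewrite -sqrtr_sqr ler_wsqrtr// (bigD1 i)//= (bigD1 j)//= -addrA lerDl addr_ge0//.
  by apply: sumr_ge0 => k _; exact: sqr_ge0.
by apply: sumr_ge0 => k _; apply: sumr_ge0 => l _; exact: sqr_ge0.
Qed.

Lemma eucl_le_mx_norm X : eucl_norm X <= (m * n)%:R * `|X|.
Proof.
rewrite -[leRHS]ger0_norm ?mulr_ge0// -sqrtr_sqr ler_wsqrtr//.
apply: le_trans (_ : \sum_(i < m) \sum_(j < n) `|X| ^+ 2 <= _).
  apply: ler_sum => i _; apply: ler_sum => j _.
  by rewrite -[leLHS]real_normK ?num_real // lerXn2r ?nnegrE// ler_entry.
under eq_bigr do rewrite sumr_const card_ord.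
rewrite sumr_const card_ord -mulrnA mulnC -[leLHS]mulr_natl exprMn ler_wpM2r ?sqr_ge0//.
by rewrite -natrX ler_nat; case: (m * n)%N => // k; rewrite leq_pmulr.
Qed.

Lemma local_hausdorff_near (A : nat -> set 'M[R]_(m, n)) B r e :
  local_hausdorff_cvg A B -> 0 < r -> 0 < e ->
  \forall k \near \oo,
    trunc (closure (A k)) r `<=` eucl_nbhd (trunc (closure B) r) e /\
    trunc (closure B) r `<=` eucl_nbhd (trunc (closure (A k)) r) e.
Proof.
move=> AB r0 e0; have cvg0 := AB r r0.
have lt_e : \forall k \near \oo,
    (hausdorff_dist (trunc (closure (A k)) r) (trunc (closure B) r) < e%:E)%E.
  apply: (cvg0 [set x | (x < e%:E)%E]).
  by apply: open_nbhs_nbhs; split; [exact: open_ereal_lt_ereal|rewrite /= lte_fin].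
apply: filterS lt_e => k /ereal_inf_lt[_ [d [d0 dA dB] <-]]; rewrite lte_fin => de.
by split=> X; [move=> /dA|move=> /dB] => -[Y YB XY]; exists Y => //; exact: lt_trans de.
Qed.

(** X is close to X_k, which is close to a point of the closure of B as soon as
    the truncation radius exceeds the norms of the X_k. *)
Lemma local_hausdorff_outer (F : set_system nat) (A : nat -> set 'M[R]_(m, n)) B :
  ProperFilter F -> \oo `<=` F -> local_hausdorff_cvg A B ->
  forall (X_ : nat -> 'M[R]_(m, n)) X, X_ @ F --> X -> (\forall k \near F, A k (X_ k)) -> closure B X.
Proof.
move=> FF ooF AB X_ X XX XA; apply/closureP => e e0.
have e3 : 0 < e / 3 by rewrite divr_gt0.
pose r := (m * n)%:R * (`|X| + e / 3) + 1.
have r0 : 0 < r by rewrite ltr_wpDl// mulr_ge0// addr_ge0// ltW.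
have near_X : \forall k \near F, `|X - X_ k| < e / 3 by exact: cvgr_dist_lt XX _ _.
have [k [[Ak Xk] [AB_ _]]] :=
  filter_ex (filterI (filterI XA near_X) (ooF _ (local_hausdorff_near AB r0 e3))).
have [|Y [clY _] XY] := AB_ (X_ k).
  split; first exact: subset_closure.
  apply: le_trans (eucl_le_mx_norm _) _; rewrite /r ler_wpDr// ler_wpM2l//.
  rewrite -[X_ k](subKr X); apply: le_trans (ler_normB _ _) _.
  by rewrite lerD2l ltW.
have /closureP/(_ _ e3)[Z BZ YZ] := clY; exists Z => //.
have := le_lt_trans (mx_norm_le_eucl _) XY.
have -> : X - Z = (X - X_ k) + (X_ k - Y) + (Y - Z) by rewrite !addrA !subrK.
have := ler_normD (X - X_ k + (X_ k - Y)) (Y - Z).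
have := ler_normD (X - X_ k) (X_ k - Y); lra.
Qed.

(** For large k every point of a ball about X is close to a point of the convex
    set A_k; by [convex_near_ball] the closure of A_k contains the ball of half
    the radius, and A_k contains its interior. *)
Lemma local_hausdorff_inner (A : nat -> set 'M[R]_(m, n)) B :
  local_hausdorff_cvg A B -> (forall k, convex (A k)) -> (forall k, open (A k)) ->
  open B -> inner_limit \oo A B.
Proof.
move=> AB cA oA oB X BX; have [s s0 sB] := openP oB BX.
pose d := s / 2; have d0 : 0 < d by rewrite divr_gt0.
pose r := (m * n)%:R * (`|X| + s) + 1.
have r0 : 0 < r by rewrite ltr_wpDl// mulr_ge0// addr_ge0// ltW.
have d2 : 0 < d / 2 by rewrite divr_gt0.
exists d => //; apply: filterS (local_hausdorff_near AB r0 d2) => k [_ BA].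
have near_A Y : `|X - Y| < d + d -> exists2 c, A k c & `|Y - c| < d.
  rewrite -splitr => XY; have [|Y' [clY' _] YY'] := BA Y.
    split; first by apply: subset_closure; exact: sB.
    apply: le_trans (eucl_le_mx_norm _) _; rewrite /r ler_wpDr// ler_wpM2l//.
    rewrite -[Y](subKr X); apply: le_trans (ler_normB _ _) _.
    by rewrite lerD2l ltW.
  have /closureP/(_ _ d2)[Z AZ YZ] := clY'; exists Z => //.
  have := le_lt_trans (mx_norm_le_eucl _) YY'.
  have -> : Y - Z = (Y - Y') + (Y' - Z) by rewrite addrA subrK.
  have := ler_normD (Y - Y') (Y' - Z); lra.
have A0 : A k !=set0.
  have [|c Ac _] := near_A X; last by exists c.
  by rewrite subrr normr0 addr_gt0.
have clA := convex_near_ball (cA k) d0 near_A.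
move=> Y XY; apply: (convex_open_int_closure (e := d - `|X - Y|)) => //.
  by rewrite subr_gt0.
move=> Y' YY'; apply: clA.
have -> : X - Y' = (X - Y) + (Y - Y') by rewrite addrA subrK.
by apply: le_lt_trans (ler_normD _ _) _; lra.
Qed.

End hausdorff_limits.

(** * Affine charts of the Grassmannian *)

Section tuples_as_matrices.
Variables (R : realType) (p n : nat).
Implicit Types (t : p.-tuple 'rV[R]_n) (M : 'M[R]_(p, n)).

Definition rowsmx t : 'M[R]_(p, n) := \matrix_i tnth t i.
Definition rowtuple M : p.-tuple 'rV[R]_n := [tuple row i M | i < p].

Lemma rowtupleK M : rowsmx (rowtuple M) = M.
Proof. by apply/row_matrixP => i; rewrite rowK tnth_mktuple. Qed.

Lemma mul_rowsmx (c : 'rV[R]_p) t : c *m rowsmx t = \sum_i c 0 i *: t`_i.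
Proof. by rewrite mulmx_sum_row; apply: eq_bigr => i _; rewrite rowK (tnth_nth 0). Qed.

Lemma memv_rowsmxP t v : reflect (exists c, v = c *m rowsmx t) (v \in <<t>>%VS).
Proof.
apply: (iffP idP) => [/coord_span vE|[c ->]].
  exists (\row_i coord t i v); rewrite mul_rowsmx {1}vE.
  by apply: eq_bigr => i _; rewrite mxE.
rewrite mul_rowsmx; apply: rpred_sum => i _; apply: rpredZ.
by apply: memv_span; rewrite mem_nth// size_tuple.
Qed.

Lemma span_rowsmxS (m : nat) (s : m.-tuple 'rV[R]_n) t (T : 'M[R]_(m, p)) :
  \matrix_i tnth s i = T *m rowsmx t -> (<< s >> <= << t >>)%VS.
Proof.
move=> sE; apply/span_subvP => _ /tnthP[i ->]; apply/memv_rowsmxP.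
by exists (row i T); rewrite -row_mul -sE rowK.
Qed.

Lemma free_rowsmxP t : reflect (forall c : 'rV[R]_p, c *m rowsmx t = 0 -> c = 0) (free t).
Proof.
apply: (iffP freeP) => [ft c|ft k kt0 i].
  by rewrite mul_rowsmx => /ft c0; apply/rowP => i; rewrite c0 mxE.
have /ft/rowP/(_ i) : (\row_i k i) *m rowsmx t = 0.
  by rewrite mul_rowsmx -[RHS]kt0; apply: eq_bigr => j _; rewrite mxE.
by rewrite !mxE.
Qed.

Lemma free_row_free t : free t = row_free (rowsmx t).
Proof.
apply/free_rowsmxP/idP => [ft|rf c c0]; first exact: inj_row_free.
by apply/eqP; rewrite -(mulmx_free_eq0 _ rf) c0.
Qed.

End tuples_as_matrices.

Section charts.
Variables (R : realType) (p q : nat).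
Variables (W0 U0 : {vspace 'rV[R]_(p + q)}) (u : p.-tuple 'rV[R]_(p + q)) (w : q.-tuple 'rV[R]_(p + q)).
Hypotheses (hU0 : affine_chart p W0 U0) (hu : basis_of U0 u) (hw : basis_of W0 w).

Definition frame : 'M[R]_(p + q) := col_mx (rowsmx u) (rowsmx w).

(** A relation between the two bases is a vector common to U0 and W0. *)
Lemma frame_unit : frame \in unitmx.
Proof.
rewrite -row_free_unit; apply: inj_row_free => c; rewrite -[c]hsubmxK mul_row_col.
set cu := lsubmx c; set cw := rsubmx c => E.
have uU : cu *m rowsmx u \in U0.
  by rewrite -(span_basis hu); apply/memv_rowsmxP; exists cu.
have wW : cw *m rowsmx w \in W0.
  by rewrite -(span_basis hw); apply/memv_rowsmxP; exists cw.
have u0 : cu *m rowsmx u = 0.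
  apply/eqP; rewrite -memv0 -(proj2 hU0) memv_cap uU.
  by move/eqP: E; rewrite addr_eq0 => /eqP ->; rewrite rpredN.
move: E; rewrite u0 add0r => w0.
have -> : cu = 0 by move/basis_free/free_rowsmxP: hu; exact.
have -> : cw = 0 by move/basis_free/free_rowsmxP: hw; exact.
by rewrite row_mx0.
Qed.

Definition graph_tuple (X : 'M[R]_(q, p)) : p.-tuple 'rV[R]_(p + q) :=
  rowtuple ((col_mx 1%:M X)^T *m frame).

Lemma graphE X : graph u w X = <<graph_tuple X>>%VS.
Proof.
rewrite /graph; congr (<<_>>)%VS; congr tval.
apply: eq_from_tnth => i; rewrite !tnth_mktuple.
rewrite tr_col_mx trmx1 mul_row_col mul1mx linearD /= rowK; congr (_ + _).
rewrite row_mul mulmx_sum_row; apply: eq_bigr => k _.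
by rewrite rowK !mxE.
Qed.

Lemma rowsmx_graph X : rowsmx (graph_tuple X) = (col_mx 1%:M X)^T *m frame.
Proof. exact: rowtupleK. Qed.

(** In the frame, a basis of U is a matrix (A | B). A row vector killed by A
    yields a vector of U in W0, so A is invertible, and A^-1 (A | B) = (1 | X^T). *)
Lemma chart_graph U : affine_chart p W0 U -> exists X, U = graph u w X.
Proof.
case=> dU UW.
have [t tU] : exists t : p.-tuple 'rV[R]_(p + q), basis_of U t.
  by exists (tcast dU (vbasis U)); rewrite val_tcast; exact: vbasisP.
pose A := lsubmx (rowsmx t *m invmx frame); pose B := rsubmx (rowsmx t *m invmx frame).
have tE : rowsmx t = row_mx A B *m frame by rewrite hsubmxK mulmxKV ?frame_unit.
have uA : A \in unitmx.
  rewrite -row_free_unit; apply: inj_row_free => c cA.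
  have /free_rowsmxP := basis_free tU; apply.
  apply/eqP; rewrite -memv0 -UW memv_cap -{1}(span_basis tU); apply/andP; split.
    by apply/memv_rowsmxP; exists c.
  rewrite tE mulmxA mul_mx_row cA mul_row_col mul0mx add0r -(span_basis hw).
  by apply/memv_rowsmxP; exists (c *m B).
exists (invmx A *m B)^T; rewrite graphE -(span_basis tU).
have gE : rowsmx (graph_tuple (invmx A *m B)^T) = invmx A *m rowsmx t.
  rewrite rowsmx_graph tr_col_mx trmx1 trmxK tE mulmxA mul_mx_row mulVmx//.
apply/eqP; rewrite eqEsubv (span_rowsmxS gE) (span_rowsmxS (T := A)) ?andbT//.
by rewrite gE mulKVmx.
Qed.

(** Subspaces are row spans while [frac] acts on columns, hence the transpose. *)
Lemma graph_frac (g : 'End('rV[R]_(p + q))) (G : 'M[R]_(p + q)) X Y :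
  G \in unitmx -> G = (frame *m lin1_mx g *m invmx frame)^T ->
  (g @: graph u w X)%VS = graph u w Y <-> frac G X Y.
Proof.
move=> uG GE.
have rowsg : \matrix_i tnth (map_tuple g (graph_tuple X)) i =
    (G *m col_mx 1%:M X)^T *m frame.
  rewrite GE trmx_mul trmxK !mulmxA mulmxKV ?frame_unit// -rowsmx_graph.
  by apply/row_matrixP => i; rewrite rowK tnth_map row_mul mul_rV_lin1 rowK.
rewrite !graphE limg_span; split=> [gXY|XY].
  apply/fracP.
  have rowT i : exists c, tnth (map_tuple g (graph_tuple X)) i = c *m rowsmx (graph_tuple Y).
    by apply/memv_rowsmxP; rewrite -gXY; apply: memv_span; exact: mem_tnth.
  have [c cE] := choice rowT; exists (\matrix_i c i)^T.
  have : (G *m col_mx 1%:M X)^T *m frame = (\matrix_i c i) *m rowsmx (graph_tuple Y).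
    by rewrite -rowsg; apply/row_matrixP => i; rewrite row_mul !rowK.
  rewrite rowsmx_graph mulmxA => /(can_inj (mulmxK frame_unit)).
  by move=> /(congr1 trmx); rewrite trmxK trmx_mul trmxK.
have uT := frac_den_unit uG XY.
have gE : \matrix_i tnth (map_tuple g (graph_tuple X)) i =
    (den G X)^T *m rowsmx (graph_tuple Y).
  by rewrite rowsg (frac_den XY) trmx_mul rowsmx_graph mulmxA.
apply/eqP; rewrite eqEsubv (span_rowsmxS gE).
rewrite (@span_rowsmxS _ _ _ _ _ (map_tuple g (graph_tuple X)) (invmx (den G X)^T))//.
by rewrite /rowsmx gE mulKmx ?unitmx_tr.
Qed.

Lemma PGL_frac phi : PGL phi -> exists2 G : 'M[R]_(p + q), G \in unitmx &
  forall X Y, phi (graph u w X) = graph u w Y <-> frac G X Y.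
Proof.
move=> [g [g0 ->]].
have uG : (frame *m lin1_mx g *m invmx frame)^T \in unitmx.
  rewrite unitmx_tr !unitmx_mul unitmx_inv frame_unit andbT /=.
  rewrite -row_free_unit; apply: inj_row_free => c.
  rewrite mul_rV_lin1 => gc0; have /lker0P ginj : lker g == 0%VS by rewrite g0.
  by apply: ginj; rewrite gc0 linear0.
by eexists; first exact: uG; move=> X Y; exact: graph_frac.
Qed.

Lemma frac_PGL (G : 'M[R]_(p + q)) : G \in unitmx -> exists2 phi, PGL phi &
  forall X Y, phi (graph u w X) = graph u w Y <-> frac G X Y.
Proof.
move=> uG; pose L := invmx frame *m G^T *m frame.
pose g : 'End('rV[R]_(p + q)) := linfun (mulmxr L).
have uL : L \in unitmx.
  by rewrite !unitmx_mul unitmx_inv unitmx_tr frame_unit uG.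
have Lg : lin1_mx g = L.
  by apply/row_matrixP => i; rewrite !rowE mul_rV_lin1; exact: lfunE.
exists (fun U => (g @: U)%VS).
  exists g; split=> //; apply/eqP/lker0P => x y; rewrite /g !lfunE /=.
  exact: (can_inj (mulmxK uL)).
move=> X Y; apply: graph_frac => //; rewrite Lg /L !mulmxA mulmxV ?frame_unit//.
by rewrite mul1mx mulmxK ?frame_unit// trmxK.
Qed.

End charts.

(** * Decomposable vectors *)

Section wedge_products.
Variables (R : realType) (p n : nat).
Implicit Types (M N : 'M[R]_(p, n)) (t : p.-tuple 'rV[R]_n).

Lemma wedgevE t (f : incr_map p n) : wedgev t f = \det (colsub (val f) (rowsmx t)).
Proof. by rewrite ffunE; congr (\det _); apply/matrixP => i j; rewrite !mxE. Qed.

(** Take for g the increasing enumeration of the image of f. *)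
Lemma incr_map_sort (f : 'I_p -> 'I_n) : injective f ->
  exists g : incr_map p n, forall j, exists i, f j = val g i.
Proof.
move=> finj; pose A := [set f i | i : 'I_p]%SET.
have cA : #|A| = p by rewrite card_imset// card_ord.
pose g := [ffun i : 'I_p => Order.enum_val (cast_ord (esym cA) i) : 'I_n].
have gincr : [forall i : 'I_p, forall j : 'I_p, (i < j)%N ==> (g i < g j)%N].
  apply/forallP => i; apply/forallP => j; apply/implyP => ij; rewrite !ffunE.
  have := Order.le_enum_val (@Order.TotalTheory.le_total _ _)
    (cast_ord (esym cA) j) (cast_ord (esym cA) i).
  by rewrite !leEord /= => E; rewrite ltnNge E -ltnNge.
exists (exist _ g gincr) => j.
have fA : f j \in A by rewrite imset_f.
exists (cast_ord cA (Order.enum_rank_in fA (f j))).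
by rewrite /= ffunE cast_ordK Order.enum_rankK_in.
Qed.

(** A family of rank p has an invertible p x p submatrix. Its columns may come in
    any order; listing them increasingly only multiplies it by an invertible
    matrix P. *)
Lemma wedgev_neq0 t : free t -> wedgev t != 0.
Proof.
rewrite free_row_free => rf.
have rfT : row_full (rowsmx t)^T by rewrite /row_full mxrank_tr.
have [g gP] := incr_map_sort (@fullrankfun_inj _ _ _ _ rfT).
apply/eqP => /ffunP/(_ g); rewrite wedgevE ffunE => /eqP; apply/negP.
rewrite -unitfE -unitmxE.
have := fullrowsub_unit rfT; set f := fullrankfun _ in gP *.
have -> : rowsub f (rowsmx t)^T = (colsub f (rowsmx t))^T.
  by apply/matrixP => a b; rewrite !mxE.
rewrite unitmx_tr.
pose P : 'M[R]_p := \matrix_(k, l) (val g k == f l)%:R.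
have ginj : injective (val g).
  move=> a b ab; case: (ltngtP a b) => // [ltab|ltba|]; last exact: val_inj.
    have /forallP/(_ a)/forallP/(_ b) := valP g.
    by rewrite ltab ab ltnn.
  have /forallP/(_ b)/forallP/(_ a) := valP g.
  by rewrite ltba ab ltnn.
have -> : colsub f (rowsmx t) = colsub (val g) (rowsmx t) *m P.
  apply/matrixP => a b; rewrite !mxE; have [k fk] := gP b.
  rewrite (bigD1 k)//= !mxE fk eqxx mulr1 big1 ?addr0// => l lk.
  by rewrite !mxE fk (inj_eq ginj) (negPf lk) mulr0.
by rewrite unitmx_mul => /andP[].
Qed.

Lemma wedgev_linear (M N L : 'M[R]_(p, n)) i0 b c :
  row i0 L = b *: row i0 M + c *: row i0 N ->
  row' i0 M = row' i0 L -> row' i0 N = row' i0 L ->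
  wedgev (rowtuple L) = b *: wedgev (rowtuple M) + c *: wedgev (rowtuple N).
Proof.
move=> rL rM rN; apply/ffunP => f.
rewrite [RHS]ffunE [X in _ = X + _]ffunE [X in _ = _ + X]ffunE !wedgevE !rowtupleK.
apply: (determinant_multilinear (i0 := i0)).
- by apply/rowP => j; move/rowP/(_ (val f j)): rL; rewrite !mxE.
- by apply/matrixP => i j; move/matrixP/(_ i (val f j)): rM; rewrite !mxE.
- by apply/matrixP => i j; move/matrixP/(_ i (val f j)): rN; rewrite !mxE.
Qed.

End wedge_products.

(** * Projective lines of the Grassmannian and rank-one lines *)

Section rank_one_lines.
Variables (R : realType) (p q : nat).
Variables (W0 U0 : {vspace 'rV[R]_(p + q)}) (u : p.-tuple 'rV[R]_(p + q)) (w : q.-tuple 'rV[R]_(p + q)).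
Hypotheses (hU0 : affine_chart p W0 U0) (hu : basis_of U0 u) (hw : basis_of W0 w).

(** Suppose that the domain contains the graphs of all x0 + s v y'. Row i of the
    graph of x0 + s v y' is z_i + s y'_i e, with e in W0 the vector with
    coordinates v. If y'_j0 is nonzero, subtracting multiples of row j0 removes e
    from all the other rows. So these graphs are spanned by fixed vectors
    together with one moving vector z_j0 + s y'_j0 e. Letting the moving vector
    be any nonzero c z_j0 + c' e gives a projective line in the Grassmannian,
    all of whose points with c nonzero are in the domain. Only the single point
    c = 0 can be missing, whereas properness requires two. *)
Lemma Rproper_line_free Om : Rproper p Om -> line_free (incoord u w Om).
Proof.
move=> prop x0 v y' v0 /rV0Pn[j0 yj0] line.
have uP := frame_unit hU0 hu hw.
set P := frame u w in uP.
have [Z ZE] : {Z | Z = (col_mx 1%:M x0)^T *m P} by eexists.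
pose e := (col_mx 0 v)^T *m P.
pose y := (y' 0 j0)^-1 *: y'^T; pose dl : 'rV[R]_p := delta_mx 0 j0.
pose dr : 'cV[R]_p := delta_mx j0 0.
have dly : dl *m (y - dr) = 0.
  apply/matrixP => i j; rewrite -rowE !mxE !ord1 !eqxx mulVf// subrr//.
(* 1 - D is the row operation that clears e outside row j0. *)
pose D : 'M[R]_p := (y - dr) *m dl.
have dlD : dl *m D = 0 by rewrite mulmxA dly mul0mx.
have DD : D *m D = 0 by rewrite {1}/D -mulmxA dlD mulmx0.
have D1 : (1%:M - D) *m (1%:M + D) = 1%:M.
  by rewrite mulmxDr mulmx1 mulmxBl mul1mx DD subr0 subrK.
(* Rows: z_i - y_i z_j0 outside j0, and c z_j0 + c' e at j0. *)
pose N c c' := (1%:M - D) *m Z + dr *m ((c - 1) *: row j0 Z + c' *: e).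
have N_graph s : (1%:M - D) *m rowsmx (graph_tuple u w (x0 + s *: (v *m y'))) =
    N 1 (s * y' 0 j0).
  have -> : rowsmx (graph_tuple u w (x0 + s *: (v *m y'))) = Z + s *: (y'^T *m e).
    rewrite rowsmx_graph -/P ZE /e mulmxA [in RHS]scalemxAl -mulmxDl; congr (_ *m _).
    rewrite !tr_col_mx trmx0 mul_mx_row mulmx0 scale_row_mx scaler0 add_row_mx addr0.
    by rewrite linearD linearZ /= trmx_mul.
  rewrite mulmxDr /N subrr scale0r add0r; congr (_ + _).
  rewrite -scalemxAr mulmxA -scalemxAr -scalerA; congr (_ *: _).
  rewrite scalemxAl; congr (_ *m _).
  have -> : y'^T = y' 0 j0 *: y by rewrite /y scalerA divff// scale1r.
  rewrite -scalemxAr; congr (_ *: _); rewrite mulmxBl mul1mx.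
  have dlE : dl *m y = 1%:M.
    have -> : dl *m y = dl *m dr by apply/eqP; rewrite -subr_eq0 -mulmxBr dly.
    by rewrite mul_delta_mx; apply/matrixP => a b; rewrite !mxE !ord1.
  by rewrite /D -mulmxA dlE mulmx1 subKr.
have indep (b : 'rV[R]_p) (mu : R) : b *m Z + mu *: e = 0 -> b = 0 /\ mu = 0.
  rewrite ZE /e mulmxA scalemxAl -mulmxDl => /(congr1 (mulmx^~ (invmx P))).
  rewrite mulmxK// mul0mx !tr_col_mx trmx0 trmx1 mul_mx_row mulmx1 scale_row_mx.
  rewrite scaler0 add_row_mx addr0 -row_mx0 => /eq_row_mx[-> ].
  rewrite mul0mx add0r => /eqP; rewrite scaler_eq0 => /orP[/eqP //|].
  by rewrite trmx_eq0 (negPf v0).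
have N_free c c' : (c != 0) || (c' != 0) -> free (rowtuple (N c c')).
  move=> cc; apply/free_rowsmxP => a; rewrite rowtupleK /N mulmxDr.
  rewrite [a *m (_ *m Z)]mulmxA [a *m (dr *m _)]mulmxA.
  have -> : a *m dr = (a 0 j0)%:M.
    by rewrite -colE; apply/matrixP => i j; rewrite !ord1 !mxE.
  rewrite mul_scalar_mx scalerDr !scalerA rowE -/dl addrA scalemxAl -mulmxDl.
  move=> /indep[a0 ac'].
  have aE : a = - ((a 0 j0 * (c - 1)) *: dl).
    move/(congr1 (mulmx^~ (1%:M + D))): a0; rewrite mulmxDl mul0mx -mulmxA D1 mulmx1.
    rewrite -scalemxAl mulmxDr mulmx1 dlD addr0.
    by move/eqP; rewrite addr_eq0 => /eqP.
  have ac : a 0 j0 * c = 0.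
    have := congr1 (fun M : 'rV[R]_p => M 0 j0) aE; rewrite !mxE !eqxx mulr1.
    by move/eqP; rewrite -addr_eq0 mulrBr mulr1 addrC subrK => /eqP.
  have aj0 : a 0 j0 = 0.
    by move/eqP: ac; move/eqP: ac'; rewrite !mulf_eq0; case: eqP => //=; case/orP: cc => /negPf ->.
  by rewrite aE aj0 mul0r scale0r oppr0.
have row_N c c' : row j0 (N c c') = c *: row j0 Z + c' *: e.
  rewrite /N linearD /= !row_mul linearB /= row1 -/dl.
  have -> : row j0 D = 0 by rewrite rowE.
  have -> : row j0 dr = 1%:M.
    by apply/matrixP => a b; rewrite !ord1 !mxE !eqxx.
  rewrite subr0 mul1mx -rowE scalerBl scale1r addrA.
  by rewrite [row j0 Z + _]addrC subrK.
have row'_N c c' : row' j0 (N c c') = row' j0 ((1%:M - D) *m Z).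
  rewrite /N linearD /=; set M := (c - 1) *: _ + _.
  suff -> : row' j0 (dr *m M) = 0 by rewrite addr0.
  apply/matrixP => i j; rewrite !mxE big1// => k _.
  by rewrite [dr _ _]mxE [lift _ _ == _]eq_sym (negPf (neq_lift _ _)) mul0r.
pose alpha := wedgev (rowtuple (N 1 0)); pose beta := wedgev (rowtuple (N 0 1)).
have wedge_N c c' : wedgev (rowtuple (N c c')) = c *: alpha + c' *: beta.
  apply: (wedgev_linear (i0 := j0)); rewrite ?row'_N// !row_N.
  by rewrite !scale0r !scale1r addr0 add0r.
have wedge_neq0 c c' : (c != 0) || (c' != 0) -> c *: alpha + c' *: beta != 0.
  by move=> cc; rewrite -wedge_N; apply: wedgev_neq0; exact: N_free.
have vlineZ (k : R) (x : extpow R p (p + q)) : k != 0 -> <[k *: x]>%VS = <[x]>%VS.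
  move=> k0; apply/eqP; rewrite eqEsubv -!memvE; apply/andP; split.
    by apply: memvZ; exact: memv_line.
  by rewrite -{1}[x](scalerK k0); apply: memvZ; exact: memv_line.
pose L := <<[:: alpha; beta]>>%VS.
have LE x : x \in L -> exists c c', x = c *: alpha + c' *: beta.
  rewrite /L span_cons span_seq1 => /memv_addP[_ /vlineP[c ->] [_ /vlineP[c' ->] ->]].
  by exists c, c'.
have dimL : \dim L = 2%N.
  suff /eqP -> : free [:: alpha; beta] by [].
  rewrite free_cons seq1_free span_seq1; apply/andP; split.
    apply/negP => /vlineP[k aE]; have := wedge_neq0 1 (- k).
    by rewrite oner_eq0 scale1r aE scaleNr subrr eqxx => /(_ isT).
  by have := wedge_neq0 0 1; rewrite oner_eq0 orbT scale0r scale1r add0r; apply.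
pose l := [set Q : {vspace extpow R p (p + q)} | \dim Q = 1%N /\ (Q <= L)%VS].
have lP Q : l Q -> exists c c', ((c != 0) || (c' != 0)) /\
    Q = <[c *: alpha + c' *: beta]>%VS.
  move=> [dQ QL]; have Q0 : Q != 0%VS by rewrite -dimv_eq0 dQ.
  have x0' : vpick Q != 0 by rewrite vpick0.
  have QE : Q = <[vpick Q]>%VS.
    by apply/eqP; rewrite eq_sym eqEdim -memvE memv_pick dQ dim_vline x0'.
  have [c [c' xE]] := LE _ (subvP QL _ (memv_pick Q)); exists c, c'.
  split; last by rewrite -xE.
  move: x0'; rewrite xE; apply: contraNT; rewrite negb_or !negbK => /andP[/eqP -> /eqP ->].
  by rewrite !scale0r addr0.
have lineL : Gr_lines R p (p + q) l.
  split; first by exists L.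
  move=> Q /lP[c [c' [cc ->]]]; exists (rowtuple (N c c')); split.
  - exact: N_free.
  - by apply/eqP; rewrite -[X in _ == X](size_tuple (rowtuple (N c c'))); exact: N_free.
  - by rewrite wedge_N.
have lbeta Q : (l `\` (l `&` plucker p Om)) Q -> Q = <[beta]>%VS.
  move=> [lQ nQ]; have [c [c' [cc QE]]] := lP Q lQ.
  have [c0|c0] := eqVneq c 0.
    by move: cc; rewrite QE c0 eqxx /= scale0r add0r => /vlineZ.
  case: nQ; split=> //; pose s := c' / c / y' 0 j0.
  have sE : s * y' 0 j0 = c' / c by rewrite divfK.
  exists (rowtuple (N 1 (s * y' 0 j0))); split.
  - by apply: N_free; rewrite oner_eq0.
  - set t := rowtuple _; pose t' := graph_tuple u w (x0 + s *: (v *m y')).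
    suff <- : (<< t' >> = << t >>)%VS by rewrite -graphE; exact: line.
    apply/eqP; rewrite eqEsubv; apply/andP; split.
      apply: (span_rowsmxS (T := 1%:M + D)).
      by rewrite rowtupleK -N_graph mulmxA (mulmx1C D1) mul1mx.
    apply: (span_rowsmxS (T := 1%:M - D)).
    by rewrite N_graph; exact: rowtupleK.
  - rewrite wedge_N sE QE -[RHS](vlineZ c)//; congr (<[_]>)%VS.
    by rewrite scalerDr !scalerA mulr1 mulrC divfK.
have [Q1 [Q2 [Q12 /lbeta Q1b /lbeta Q2b]]] := prop l lineL.
by apply: Q12; rewrite Q1b.
Qed.

End rank_one_lines.

(** * Domains in a chart and the limit theorem *)

Section chart_domains.
Variables (R : realType) (p q : nat).
Variables (W0 U0 : {vspace 'rV[R]_(p + q)}) (u : p.-tuple 'rV[R]_(p + q)) (w : q.-tuple 'rV[R]_(p + q)).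
Hypotheses (hU0 : affine_chart p W0 U0) (hu : basis_of U0 u) (hw : basis_of W0 w).
Implicit Types Om : set {vspace 'rV[R]_(p + q)}.

(** Both domains lie in the chart, so every one of their points is a graph. *)
Lemma PGL_maps phi Om Om' : PGL phi -> phi @` Om = Om' ->
  Om `<=` affine_chart p W0 -> Om' `<=` affine_chart p W0 ->
  exists2 G : 'M[R]_(p + q), G \in unitmx &
    [/\ forall X Y, phi (graph u w X) = graph u w Y <-> frac G X Y,
        maps G (incoord u w Om) (incoord u w Om') &
        maps (invmx G) (incoord u w Om') (incoord u w Om)].
Proof.
move=> Pphi phiOm chOm chOm'; have [G uG GP] := PGL_frac hU0 hu hw Pphi.
exists G => //; split=> // [X OmX|Y].
  have Om'X : Om' (phi (graph u w X)) by rewrite -phiOm; exists (graph u w X).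
  have [Y YE] := chart_graph hU0 hu hw (chOm' _ Om'X).
  by exists Y; [rewrite /incoord /= -YE|exact/GP].
rewrite /incoord /= -phiOm => -[U OmU UY].
have [X XE] := chart_graph hU0 hu hw (chOm _ OmU).
exists X; first by rewrite /incoord /= -XE.
by apply: frac_inv => //; apply/GP; rewrite -XE.
Qed.

(** Openness of T is carried over from S, since G is a local homeomorphism. *)
Lemma maps_open (G : 'M[R]_(p + q)) (S T : set 'M[R]_(q, p)) : G \in unitmx ->
  open S -> maps G S T -> maps (invmx G) T S -> open T.
Proof.
move=> uG oS mST mTS; rewrite openE => Y /mTS[X SX YX].
have XY : frac G X Y.
  by rewrite -[G]invmxK; apply: frac_inv; rewrite ?unitmx_inv.
have [e e0 eS] := frac_open uG oS SX XY.
apply/nbhs_ballP; exists e => // Y'; rewrite -ball_normE /= => /eS[X' /mST[Y'' TY'' X'Y''] X'Y'].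
by rewrite (frac_inj uG X'Y' X'Y'').
Qed.

End chart_domains.

Theorem theorem1p9 (R : realType) (p q : nat) (hp : (1 <= p)%N) (hq : (1 <= q)%N)
  (W0 U0 : {vspace 'rV[R]_(p + q)})
  (hW0 : \dim W0 = q) (hU0 : affine_chart p W0 U0)
  (u : p.-tuple 'rV[R]_(p + q)) (w : q.-tuple 'rV[R]_(p + q))
  (hu : basis_of U0 u) (hw : basis_of W0 w)
  (Om : set {vspace 'rV[R]_(p + q)})
  (Om_chart : Om `<=` affine_chart p W0)
  (Om_neq0 : Om !=set0)
  (Om_proper : Rproper p Om)
  (Om_open : open (incoord u w Om))
  (Om_convex : convex_set (incoord u w Om))
  (Om_cocompact : cocompact u w Om)
  (A : nat -> {vspace 'rV[R]_(p + q)} -> {vspace 'rV[R]_(p + q)})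
  (A_aff : forall k, AffPGL W0 u w (A k))
  (A_proper : forall k, Rproper p (A k @` Om))
  (A_convex : forall k, convex_set (incoord u w (A k @` Om)))
  (Omh : set {vspace 'rV[R]_(p + q)})
  (Omh_chart : Omh `<=` affine_chart p W0)
  (Omh_neq0 : Omh !=set0)
  (Omh_proper : Rproper p Omh)
  (Omh_open : open (incoord u w Omh))
  (Omh_convex : convex_set (incoord u w Omh))
  (A_cvg : local_hausdorff_cvg (fun k => incoord u w (A k @` Om))
             (incoord u w Omh)) :
  exists Phi : {vspace 'rV[R]_(p + q)} -> {vspace 'rV[R]_(p + q)},
    PGL Phi /\ Phi @` Om = Omh.
Proof.
pose S := incoord u w Om; pose Sh := incoord u w Omh.
pose S_ k := incoord u w (A k @` Om).
have cS : convex S by exact: convex_setP.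
have cSh : convex Sh by exact: convex_setP.
have cS_ k : convex (S_ k) by exact: convex_setP (A_convex k).
have lS : line_free S by exact: Rproper_line_free hU0 hu hw _ Om_proper.
have lSh : line_free Sh by exact: Rproper_line_free hU0 hu hw _ Omh_proper.
have A_chart k : A k @` Om `<=` affine_chart p W0.
  by have [_ <- _] := A_aff k; exact: image_subset.
have [F [FU ooF]] := ultraFilterLemma (@eventually_filter).
have [K [KOm cK KE]] := Om_cocompact.
have AG k : exists2 G : 'M[R]_(p + q), G \in unitmx &
    maps G S (S_ k) /\ maps (invmx G) (S_ k) S.
  have [PA _ _] := A_aff k.
  have [G uG [_ mG mG']] := PGL_maps hU0 hu hw PA erefl Om_chart (A_chart k).
  by exists G.
have oS_ k : open (S_ k) by have [G uG [mG mG']] := AG k; exact: maps_open mG'.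
have iSh : inner_limit F S_ Sh.
  move=> X /(local_hausdorff_inner A_cvg cS_ oS_ Omh_open)[r r0 rX].
  by exists r => //; exact: ooF.
have oSh : outer_limit F S_ Sh by exact: local_hausdorff_outer.
have iS : inner_limit F (fun=> S) S.
  move=> X SX; have [r r0 rS] := openP Om_open SX.
  by exists r => //; exact: filterE.
have oS : outer_limit F (fun=> S) S.
  move=> X_ X XX SX; apply/closureP => e e0.
  have Xe : \forall k \near F, `|X - X_ k| < e by exact: cvgr_dist_lt XX _ _.
  by have [k [SXk Xk]] := filter_ex (filterI SX Xe); exists (X_ k).
have [V OmhV] := Omh_neq0.
have [y0 VE] := chart_graph hU0 hu hw (Omh_chart _ OmhV).
have Shy0 : Sh y0 by rewrite /Sh /incoord /= -VE.
(* The matrix G of A_k composed with an automorphism of Om, together with the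
   preimage of y0, which now lies in K. *)
have recentred : \forall k \near F, exists Gx : 'M[R]_(p + q) * 'M[R]_(q, p),
    [/\ Gx.1 \in unitmx, maps Gx.1 S (S_ k), maps (invmx Gx.1) (S_ k) S,
        incoord u w K Gx.2 & frac Gx.1 Gx.2 y0].
  have [r r0 rSh] := iSh _ Shy0; apply: filterS rSh => k /(_ y0).
  rewrite subrr normr0 => /(_ r0) S_y0.
  have [G uG [mG mG']] := AG k; have [x Sx y0x] := mG' _ S_y0.
  have : (\bigcup_(phi in AutGr Om) (phi @` K)) (graph u w x) by rewrite KE.
  move=> [phi [Pphi phiOm] [U KU Ux]].
  have [H uH [HP mH mH']] := PGL_maps hU0 hu hw Pphi phiOm Om_chart Om_chart.
  have [x' UE] := chart_graph hU0 hu hw (Om_chart _ (KOm _ KU)).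
  exists (G *m H, x'); split=> /=.
  - by rewrite unitmx_mul uG.
  - exact: maps_comp mH mG.
  - have -> : invmx (G *m H) = invmx H *m invmx G.
      apply: invmx_left; rewrite -mulmxA [invmx G *m _]mulmxA mulVmx// mul1mx.
      exact: mulVmx.
    exact: maps_comp mG' mH'.
  - by rewrite /incoord /= -UE.
  - apply: (frac_comp (Y := x)); first by apply/HP; rewrite -UE.
    by have := frac_inv _ y0x; rewrite unitmx_inv invmxK; exact.
have [Gx GxP] := near_choice FU recentred.
have [|x Kx xx] := ultra_cvg_compact (f := fun k => (Gx k).2) FU cK.
  by apply: filterS GxP => k [].
have Sx : S x by exact: KOm.
have [G uG [mG mG']] : exists2 G : 'M[R]_(p + q), G \in unitmx &
    maps G S Sh /\ maps (invmx G) Sh S.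
  apply: (@limit_of_equivalences R p q nat F hp hq FU (fun k => (Gx k).1)
    (fun=> S) S_ S Sh (fun k => (Gx k).2) (fun=> y0) x y0) => //.
  - exact: filterE.
  - exact: filterE.
  - by apply: filterS GxP => k [].
  - by apply: filterS GxP => k [].
  - by apply: filterS GxP => k [].
  - exact: cvg_cst.
  - by apply: filterS GxP => k [].
have [Phi PPhi PhiE] := frac_PGL hU0 hu hw uG.
exists Phi; split=> //; rewrite eqEsubset; split=> [_ [U OmU <-]|V' OmhV'].
  have [X UE] := chart_graph hU0 hu hw (Om_chart _ OmU).
  have [|Y ShY XY] := mG X; first by rewrite /S /incoord /= -UE.
  by rewrite UE (iffRL (PhiE X Y) XY).
have [Y V'E] := chart_graph hU0 hu hw (Omh_chart _ OmhV').
have [|X SX YX] := mG' Y; first by rewrite /Sh /incoord /= -V'E.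
exists (graph u w X) => //; rewrite V'E; apply/PhiE.
by have := frac_inv _ YX; rewrite unitmx_inv invmxK; exact.
Qed.
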